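(* Let $\alpha \ge 0$. Assume that $F:\mathbb{R}^d\to\mathbb{R}^p$ is continuous and that there exists $C_\alpha\ge 0$ with $\sup_{x\in\mathbb{R}^d}\|F(x)\|(1+\|x\|^\alpha)^{-1}\le C_\alpha<+\infty$. Then the following hold. (a) If there exists a solution of (P) and $v(\mathrm{P})<+\infty$, then there exist $\theta^\star\in\mathbb{R}^p$ and a Borel set $N\subset\mathbb{R}^d$ with $\pi(N)=0$ for every $\pi\in\mathcal{P}_\alpha^F$ such that $\mathrm{KL}(\pi|\mu)<+\infty$, such that the solution of (P) is the probability measure $\pi_{\theta^\star}$ given for $\mu$-almost every $x\in\mathbb{R}^d$ by $$\frac{\mathrm{d}\pi_{\theta^\star}}{\mathrm{d}\mu}(x)=\begin{cases}\exp[-\langle\theta^\star,F(x)\rangle]\Big/\int_{\mathbb{R}^d\setminus N}\exp[-\langle\theta^\star,F(y)\rangle]\,\mathrm{d}\mu(y) & \text{if } x\notin N,\\ 0 & \text{otherwise.}\end{cases}\qquad ( * )$$ If moreover there exists $\pi\in\mathcal{P}_\alpha^F$ with $\mathrm{KL}(\pi|\mu)<+\infty$ and $\mu\ll\pi$, then $\theta^\star$ is a solution of (Q), the probability measure with density $x\mapsto \exp[-\langle\theta^\star,F(x)\rangle-L(\theta^\star)]$ with respect to $\mu$ is a solution of (P), and $v(\mathrm{Q})=v(\mathrm{P})$. (b) Assume in addition that there exist $\alpha'>\alpha$ and $\eta>0$ such that $\int_{\mathbb{R}^d}\exp[\eta\|x\|^{\alpha'}]\,\mathrm{d}\mu(x)<+\infty$.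 Then there exists a solution $\pi_{\theta^\star}$ of (P) (of the form $( * )$) with $v(\mathrm{P})<+\infty$ if and only if there exists $\pi\in\mathcal{P}_\alpha^F$ such that $\mathrm{KL}(\pi|\mu)<+\infty$.
   Context: $\mu$ is a probability measure on $(\mathbb{R}^d,\mathcal{B}(\mathbb{R}^d))$ (the reference measure), $F:\mathbb{R}^d\to\mathbb{R}^p$ is measurable, and there is a point $x_0\in\mathbb{R}^d$ with $F(x_0)=0$ (standing assumption). For a probability measure $\pi$, $\pi(F)=\int F\,\mathrm{d}\pi$. $\mathcal{P}_\alpha$ is the set of Borel probability measures $\pi$ on $\mathbb{R}^d$ with $\int\|x\|^\alpha\,\mathrm{d}\pi(x)<+\infty$, and $\mathcal{P}_\alpha^F=\{\pi\in\mathcal{P}_\alpha:\pi(F)=0\}$. $\mathrm{KL}(\pi|\mu)=\int \frac{\mathrm{d}\pi}{\mathrm{d}\mu}\log\frac{\mathrm{d}\pi}{\mathrm{d}\mu}\,\mathrm{d}\mu$ if $\pi\ll\mu$ and $+\infty$ otherwise. Problem (P): minimize $\mathrm{KL}(\pi|\mu)$ subject to $\pi\in\mathcal{P}_\alpha^F$; $v(\mathrm{P})=\inf_{\pi\in\mathcal{P}_\alpha^F}\mathrm{KL}(\pi|\mu)$. Let $\Theta_F=\{\theta\in\mathbb{R}^p:\int\exp[-\langle\theta,F(x)\rangle]\,\mathrm{d}\mu(x)<+\infty\}$. Problem (Q): maximize $\inf_{\pi\in\mathcal{P}_\alpha}\{\mathrm{KL}(\pi|\mu)+\langle\theta,\pi(F)\rangle\}$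 subject to $\theta\in\Theta_F$; $v(\mathrm{Q})$ is the supremum over $\Theta_F$ of this quantity. $L(\theta)=\log\int\exp[-\langle\theta,F(x)\rangle]\,\mathrm{d}\mu(x)$ for $\theta\in\Theta_F$. *)

(* Defs.v *)
From HB Require Import structures.
From mathcomp Require Import all_boot all_order all_algebra.
From mathcomp Require Import all_classical all_reals all_analysis.
Import Order.TTheory GRing.Theory Num.Theory.
Import numFieldNormedType.Exports.
Set Implicit Arguments.
Unset Strict Implicit.
Unset Printing Implicit Defensive.
Local Open Scope classical_set_scope.
Local Open Scope ring_scope.
Local Open Scope charge_scope.

Definition dotp (R : realType) (n : nat) (u v : 'rV[R]_n) : R :=
  \sum_(i < n) u 0 i * v 0 i.

(* The library norm on ['rV[R]_n] is the sup norm, hence this one. *)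
Definition enorm (R : realType) (n : nat) (u : 'rV[R]_n) : R :=
  Num.sqrt (dotp u u).

(* R^n with its Borel sigma-algebra: the carrier is convertible to ['rV[R]_n],
   and the sigma-algebra is generated by the open sets of ['rV[R]_n], whose
   sup-norm topology is the Euclidean one. *)
Notation borel_rV R n := (g_sigma_algebraType (@open 'rV[R]_n)).

Section KullbackLeibler.
Context {d : measure_display} {T : measurableType d} {R : realType}.
Implicit Types pi mu : probability T R.

Definition dens pi mu : T -> \bar R := 'd (charge_of_finite_measure pi) '/d mu.

(* 0 log 0 = 0, because [lne 0 = -oo] and [0 * -oo = 0]. *)
Definition KL pi mu : \bar R :=
  if `[< pi `<< mu >] then (\int[mu]_x (dens pi mu x * lne (dens pi mu x)))%E
  else +oo%E.

Definition has_density pi mu (f : T -> R) : Prop :=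
  pi `<< mu /\ {ae mu, forall x, dens pi mu x = (f x)%:E}.

End KullbackLeibler.

Section MaximumEntropy.
Context {R : realType} {d p : nat}.
Variables (mu : probability (borel_rV R d) R) (F : 'rV[R]_d -> 'rV[R]_p).
Variable alpha : R.
Implicit Type theta : 'rV[R]_p.
Local Notation prob := (probability (borel_rV R d) R).

(* [Rintegral] is total; it is only used where F is pi-integrable, which the
   growth bound on F ensures for pi with a finite alpha-moment. *)
Definition mean (pi : prob) : 'rV[R]_p := \row_i \int[pi]_x (F x 0 i).

Definition Palpha : set prob :=
  [set pi : prob | (\int[pi]_x (enorm x `^ alpha)%:E < +oo)%E].

Definition PFalpha : set prob :=
  [set pi : prob | Palpha pi /\ mean pi = 0].

Definition vP : \bar R := ereal_inf [set KL pi mu | pi in PFalpha].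

Definition solvesP (pi : prob) : Prop :=
  PFalpha pi /\ forall pi', PFalpha pi' -> (KL pi mu <= KL pi' mu)%E.

Definition Theta : set 'rV[R]_p :=
  [set theta | (\int[mu]_x (expR (- dotp theta (F x)))%:E < +oo)%E].

Definition dual theta : \bar R :=
  ereal_inf [set (KL pi mu + (dotp theta (mean pi))%:E)%E | pi in Palpha].

Definition vQ : \bar R := ereal_sup [set dual theta | theta in Theta].

Definition solvesQ theta : Prop :=
  Theta theta /\ forall theta', Theta theta' -> (dual theta' <= dual theta)%E.

Definition logZ theta : R := ln (\int[mu]_x expR (- dotp theta (F x))).

Definition gibbs_off (N : set (borel_rV R d)) theta (x : borel_rV R d) : R :=
  if x \in N then 0
  else expR (- dotp theta (F x)) /
       \int[mu]_(y in ~` N) expR (- dotp theta (F y)).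

Definition feasible_null (N : set (borel_rV R d)) : Prop :=
  measurable N /\ forall pi, PFalpha pi -> (KL pi mu < +oo)%E -> pi N = 0%E.

End MaximumEntropy.

(* Main.v *)
(** Everything is expressed through densities [f] with respect to [mu], so that
    [KL] becomes the integral of [f ln f].

    Perturbing a minimizer [f] to [(1 + t h) f], with [h] bounded and
    [f]-orthogonal to [1] and to the coordinates of [F], shows that [h f ln f]
    has integral zero; as only finitely many constraints are involved, [ln f]
    lies in the span of [1, F_1, ..., F_p] on [{f != 0}].  The slope [-oo] of
    [t ln t] at [0] forces every feasible density of finite entropy to vanish on
    [N = {f = 0}].  Gibbs' inequality then gives weak duality, with equality as
    soon as [N] is [mu]-null.

    For existence, no weak compactness is used: the Hellinger lower bound
    [(sqrt a - sqrt b)^2 / 2] for the convexity gap of [u ln u] makes the square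
    roots of a minimizing sequence converge almost everywhere.  Fatou's lemma
    applied to the nonnegative Young deficits
    [f_n ln f_n - f_n - lambda f_n G + exp (lambda G)], followed by
    [lambda -> +oo], shows that mass and constraints pass to the limit. *)

Require Import Defs.
From HB Require Import structures.
From mathcomp Require Import all_boot all_order all_algebra.
From mathcomp Require Import all_classical all_reals all_analysis.
From mathcomp Require Import measurable_realfun ring lra.
Import Order.TTheory GRing.Theory Num.Theory.
Import numFieldNormedType.Exports.
Local Open Scope classical_set_scope.
Local Open Scope ring_scope.

(** * The function u ln u *)

Section xlnx.
Context {R : realType}.
Implicit Types a b m t u : R.

Definition xlnx u : R := u * ln u.

Lemma xlnx0 : xlnx 0 = 0. Proof. by rewrite /xlnx mul0r. Qed.

(** Fenchel-Young inequality for the conjugate pair [u ln u - u] and [exp]. It is [1 + y <= exp y]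
    at [y = b - ln a], multiplied by [a]. *)
Lemma xlnx_young a b : 0 <= a -> a * b <= xlnx a - a + expR b.
Proof.
rewrite le_eqVlt => /predU1P[<-|a0].
  by rewrite xlnx0 mul0r subr0 add0r expR_ge0.
have : a * (1 + (b - ln a)) <= a * expR (b - ln a).
  by rewrite ler_pM2l// expR_ge1Dx.
rewrite expRB lnK ?posrE// mulrCA divff ?gt_eqF// mulr1 /xlnx.
lra.
Qed.

Lemma xlnx_tangent a m : 0 <= a -> 0 < m -> a * ln m + a - m <= xlnx a.
Proof.
move=> a0 m0; have := xlnx_young a (ln m) a0; rewrite lnK ?posrE//; lra.
Qed.

Lemma xlnx_ge u : 0 <= u -> u - 1 <= xlnx u.
Proof. by move=> u0; have := xlnx_young u 0 u0; rewrite expR0; lra. Qed.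

Lemma xlnx_le u : 0 <= u -> xlnx u <= u * (u - 1).
Proof.
rewrite le_eqVlt => /predU1P[<-|u0]; first by rewrite xlnx0 mul0r.
rewrite /xlnx ler_pM2l//.
have := expR_ge1Dx (ln u); rewrite lnK ?posrE//; lra.
Qed.

(** Average the tangent-line bounds taken at the mixture [m] itself. The case [m = 0] is apart,
    since there is no tangent there, but then both weighted terms vanish. *)
Lemma xlnx_convex t a b : 0 <= t <= 1 -> 0 <= a -> 0 <= b ->
  xlnx ((1 - t) * a + t * b) <= (1 - t) * xlnx a + t * xlnx b.
Proof.
move=> /andP[t0 t1] a0 b0; set m := (1 - t) * a + t * b.
have s0 : 0 <= 1 - t by lra.
have ta : 0 <= (1 - t) * a by rewrite mulr_ge0.
have tb : 0 <= t * b by rewrite mulr_ge0.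
have : 0 <= m by rewrite addr_ge0.
rewrite le_eqVlt => /predU1P[m0|m0].
  have /eqP/eqP a00 : (1 - t) * a = 0 by rewrite /m in m0; lra.
  have b00 : t * b = 0 by rewrite /m in m0; lra.
  by rewrite -m0 xlnx0 /xlnx !mulrA a00 b00 !mul0r addr0.
have Ha := xlnx_tangent a m a0 m0; have Hb := xlnx_tangent b m b0 m0.
have : (1 - t) * (a * ln m + a - m) + t * (b * ln m + b - m) <=
  (1 - t) * xlnx a + t * xlnx b by apply: lerD; rewrite ler_wpM2l.
apply: le_trans; rewrite {1}/xlnx.
have -> : (1 - t) * (a * ln m + a - m) + t * (b * ln m + b - m) =
  ((1 - t) * a + t * b) * ln m + ((1 - t) * a + t * b) - m by ring.
by rewrite -/m; lra.
Qed.

(* [a ln (a / m) = - 2 a ln (sqrt m / sqrt a)], bounded below by [ln y <= y - 1]. *)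
Lemma xlnx_hellinger_half a m : 0 <= a -> 0 < m ->
  2 * a - 2 * (Num.sqrt a * Num.sqrt m) <= xlnx a - a * ln m.
Proof.
move=> a0 m0; case: (ltgtP 0 a) a0 => // [a0 _|<- _]; last first.
  by rewrite sqrtr0 xlnx0 !mul0r mulr0 subr0.
have sa : 0 < Num.sqrt a by rewrite sqrtr_gt0.
have sm : 0 < Num.sqrt m by rewrite sqrtr_gt0.
have lna (c : R) : 0 < c -> ln c = 2 * ln (Num.sqrt c).
  move=> c0; rewrite -{1}(sqr_sqrtr (ltW c0)) lnXn ?sqrtr_gt0//.
  by rewrite mulr_natl.
have := expR_ge1Dx (ln (Num.sqrt m / Num.sqrt a)).
rewrite lnK ?posrE ?divr_gt0// ln_div ?posrE// => H.
have {}H : a * (1 + (ln (Num.sqrt m) - ln (Num.sqrt a))) <=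
    Num.sqrt a * Num.sqrt m.
  rewrite -[X in X * (_ + _)](sqr_sqrtr (ltW a0)).
  apply: (@le_trans _ _ (Num.sqrt a ^+ 2 * (Num.sqrt m / Num.sqrt a))).
    by rewrite ler_pM2l// exprn_gt0.
  by rewrite expr2 -mulrA [_ * (_ / _)]mulrCA divff ?gt_eqF// mulr1.
by rewrite /xlnx (lna a)// (lna m)//; nra.
Qed.

(** Add [xlnx_hellinger_half] for [a] and for [b] at their midpoint [m]: the two [ln m] terms
    recombine into [2 * xlnx m]. *)
Lemma xlnx_hellinger a b : 0 <= a -> 0 <= b ->
  (Num.sqrt a - Num.sqrt b) ^+ 2 / 2 <=
  xlnx a + xlnx b - 2 * xlnx ((1 - 2^-1) * a + 2^-1 * b).
Proof.
move=> a0 b0; set m := (1 - 2^-1) * a + _.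
have mE : m = (a + b) / 2 by rewrite /m; field.
case: (ltgtP 0 m) => [m0|m0|m0]; last 2 first.
- have : 0 <= (a + b) / 2 by rewrite divr_ge0// addr_ge0.
  by rewrite -mE leNgt m0.
- have ab : a + b = 0 by move: m0; rewrite mE; lra.
  have -> : a = 0 by lra.
  have -> : b = 0 by lra.
  by rewrite -m0 xlnx0; rewrite subrr expr0n/= mul0r; lra.
have Ha := xlnx_hellinger_half a m a0 m0; have Hb := xlnx_hellinger_half b m b0 m0.
have sqa := sqr_sqrtr a0; have sqb := sqr_sqrtr b0.
have sqm := sqr_sqrtr (ltW m0).
have xm : xlnx m = (a + b) / 2 * ln m by rewrite /xlnx {1}mE.
have H : xlnx a + xlnx b - 2 * xlnx m =
   (xlnx a - a * ln m) + (xlnx b - b * ln m) by rewrite xm; field.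
rewrite H; apply: le_trans; last exact: lerD Ha Hb.
move: sqa sqb sqm; set x := Num.sqrt a; set y := Num.sqrt b; set z := Num.sqrt m.
move=> sqa sqb sqm.
have : z ^+ 2 = (x ^+ 2 + y ^+ 2) / 2 by rewrite sqm sqa sqb.
rewrite -sqa -sqb => zE.
(* With [z ^+ 2 = (x ^+ 2 + y ^+ 2) / 2], this square bounds [2 z (x + y)] by
   [(x + y)^2 / 2 + x^2 + y^2], which is exactly what remains to be shown. *)
have := sqr_ge0 (x + y - 2 * z); nra.
Qed.

(** Unlike [xlnx_ge], this lower bound tends to 0 at 0, as the squeeze in [cvg_xlnx] requires. *)
Lemma xlnx_ge_sqrt u : 0 <= u -> - (2 * Num.sqrt u) <= xlnx u.
Proof.
move=> u0; have := xlnx_hellinger_half u 1 u0 ltr01; rewrite ln1 mulr0 subr0 sqrtr1 mulr1.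
by apply: le_trans; lra.
Qed.

Lemma measurable_sqrtr : measurable_fun [set: R] (@Num.sqrt R).
Proof. by apply: continuous_measurable_fun; exact: sqrt_continuous. Qed.

Lemma measurable_xlnx : measurable_fun [set: R] xlnx.
Proof. by by apply: measurable_funM. Qed.

(** At a positive limit [ln] is continuous; at 0, [xlnx] is squeezed between [- 2 sqrt u] and
    [u (u - 1)]. *)
Lemma cvg_xlnx (v : nat -> R) l : (forall n, 0 <= v n) ->
  v @ \oo --> l -> xlnx (v n) @[n --> \oo] --> xlnx l.
Proof.
move=> v0 vl.
have : 0 <= l by apply: (cvgr_to_ge vl); exact: nearW.
rewrite le_eqVlt => /predU1P[l0|l0]; last first.
  by apply: cvgM => //; apply: continuous_cvg => //; exact: continuous_ln.
move: vl; rewrite -{}l0 xlnx0 => v_0.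
apply: (@squeeze_cvgr _ _ _ _ (fun n => - (2 * Num.sqrt (v n)))
  (fun n => v n * (v n - 1))).
- by apply: nearW => n; rewrite xlnx_ge_sqrt// xlnx_le.
- rewrite -[X in _ --> X]oppr0; apply: cvgN.
  rewrite -[X in _ --> X](mulr0 2); apply: cvgM; first exact: cvg_cst.
  by rewrite -[X in _ --> X]sqrtr0; apply: continuous_cvg => //; exact: sqrt_continuous.
- rewrite -[X in _ --> X](mul0r (0 - 1)); apply: cvgM => //.
  by apply: cvgB => //; exact: cvg_cst.
Qed.

End xlnx.

(** * Integrable real functions *)

Section real_integrable.
Context {d} {T : measurableType d} {R : realType} (mu : probability T R).
Implicit Types f g h : T -> R.

Definition rint f := mu.-integrable setT (EFin \o f).

Lemma rint_measurable f : rint f -> measurable_fun setT f.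
Proof. by move=> /measurable_int/measurable_EFinP. Qed.

Lemma rintD f g : rint f -> rint g -> rint (fun x => f x + g x).
Proof. by move=> rf rg; exact: (integrableD _ rf rg). Qed.

Lemma rintB f g : rint f -> rint g -> rint (fun x => f x - g x).
Proof. by move=> rf rg; exact: (integrableB _ rf rg). Qed.

Lemma rintZ k f : rint f -> rint (fun x => k * f x).
Proof. by move=> rf; exact: (integrableZl _ k rf). Qed.

Lemma rint_cst k : rint (fun=> k).
Proof. exact: finite_measure_integrable_cst. Qed.

Lemma rint_le f g : measurable_fun setT f -> (forall x, `|f x| <= g x) ->
  rint g -> rint f.
Proof.
move=> mf fg rg; apply: (le_integrable _ _ _ rg) => //.
  exact/measurable_EFinP.
by move=> x _ /=; rewrite lee_fin (le_trans (fg x))// ler_norm.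
Qed.

Lemma rint_between f g h : measurable_fun setT f -> (forall x, g x <= f x <= h x) ->
  rint g -> rint h -> rint f.
Proof.
move=> mf fgh rg rh; apply: (@rint_le _ (fun x => `|g x| + `|h x|)) => //.
  move=> x; have /andP[gf fh] := fgh x.
  have := ler_norm (h x); have := ler_norm (- g x); rewrite normrN.
  have := normr_ge0 (g x); have := normr_ge0 (h x).
  by case: (ger0P (f x)); lra.
by apply: rintD; exact: integrable_norm.
Qed.

Lemma rint_sum n (f : 'I_n -> T -> R) : (forall i, rint (f i)) ->
  rint (fun x => \sum_(i < n) f i x).
Proof.
move=> rf; rewrite /rint.
rewrite (_ : _ \o _ = fun x => (\sum_(i < n) (EFin \o f i) x)%E).
  by apply: integrable_sum => // i _; exact: rf.
by apply/funext => x /=; rewrite sumEFin.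
Qed.

Lemma RintegralZ k f : rint f -> \int[mu]_x (k * f x) = k * \int[mu]_x f x.
Proof. by move=> rf; exact: RintegralZl. Qed.

Lemma RintegralDT f g : rint f -> rint g ->
  \int[mu]_x (f x + g x) = \int[mu]_x f x + \int[mu]_x g x.
Proof. by move=> rf rg; exact: RintegralD. Qed.

Lemma RintegralBT f g : rint f -> rint g ->
  \int[mu]_x (f x - g x) = \int[mu]_x f x - \int[mu]_x g x.
Proof. by move=> rf rg; exact: RintegralB. Qed.

Lemma Rintegral_sum n (f : 'I_n -> T -> R) : (forall i, rint (f i)) ->
  \int[mu]_x (\sum_(i < n) f i x) = \sum_(i < n) \int[mu]_x f i x.
Proof.
elim: n f => [|n IH] f rf.
  under eq_Rintegral do rewrite big_ord0.
  by rewrite big_ord0 /Rintegral integral0.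
under eq_Rintegral do rewrite big_ord_recr.
by rewrite RintegralDT ?big_ord_recr ?IH//; apply: rint_sum.
Qed.

Lemma Rintegral_cstT k : \int[mu]_x k = k.
Proof.
transitivity (k * fine (mu setT)); first exact: Rintegral_cst.
by rewrite probability_setT mulr1.
Qed.

Lemma le_RintegralT f g : rint f -> rint g -> (forall x, f x <= g x) ->
  \int[mu]_x f x <= \int[mu]_x g x.
Proof. by move=> rf rg fg; apply: le_Rintegral. Qed.

Lemma Rintegral_EFin f : rint f -> (\int[mu]_x (f x)%:E)%E = (\int[mu]_x f x)%:E.
Proof. by move=> rf; rewrite /Rintegral fineK//; exact: integrable_fin_num rf. Qed.

Lemma ge0_rint f : measurable_fun setT f -> (forall x, 0 <= f x) ->
  (\int[mu]_x (f x)%:E < +oo)%E -> rint f.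
Proof.
move=> mf f0 foo; apply/integrableP; split; first exact/measurable_EFinP.
by under eq_integral do rewrite /= ger0_norm//.
Qed.

Lemma ae_Rintegral_eq f g : measurable_fun setT f -> measurable_fun setT g ->
  {ae mu, forall x, f x = g x} -> \int[mu]_x f x = \int[mu]_x g x.
Proof.
move=> mf mg fg; congr fine; apply: ae_eq_integral => //.
- exact/measurable_EFinP.
- exact/measurable_EFinP.
- by apply: filterS fg => x -> _.
Qed.

Lemma ae_rint f g : measurable_fun setT f -> measurable_fun setT g ->
  {ae mu, forall x, f x = g x} -> rint f -> rint g.
Proof.
move=> mf mg fg /integrableP[_ foo]; apply/integrableP; split.
  exact/measurable_EFinP.
rewrite (_ : integral _ _ _ = (\int[mu]_x (`|(EFin \o f) x|)%E)%E)//.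
apply: ae_eq_integral => //.
- by apply/measurable_EFinP/measurableT_comp.
- by apply/measurable_EFinP/measurableT_comp.
- by apply: filterS fg => x /= -> _.
Qed.

Lemma Rintegral_eq0_ae f : rint f -> (forall x, 0 <= f x) ->
  \int[mu]_x f x = 0 -> {ae mu, forall x, f x = 0}.
Proof.
move=> rf f0 f00.
have mf := rint_measurable f rf.
have /(ae_eq_integral_abs mu measurableT) H : measurable_fun setT (EFin \o f).
  exact/measurable_EFinP.
have : (\int[mu]_x `|(EFin \o f) x| = 0)%E.
  under eq_integral do rewrite /= ger0_norm//.
  by rewrite Rintegral_EFin// f00.
by move=> /H; apply: filterS => x /= /(_ I) [].
Qed.

End real_integrable.

(** * Linear forms vanishing on a common kernel *)

Section common_kernel.
Context {R : realType} {U : lmodType R}.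

(** Linearity is relative to [V] because an integral pairing is additive only on functions for which
    the integrals exist. *)
Definition lin_on (V : set U) (L : U -> R) :=
  forall k u v, V u -> V v -> L (k *: u + v) = k * L u + L v.

(** Induction on the number of forms: restrict to the kernel of the first form and apply the
    hypothesis to the others. If the first form vanishes on [V], its coefficient is 0; otherwise
    some [u0] outside its kernel determines the coefficient. *)
Lemma common_kernel_span n (V : set U) (phi : 'I_n -> U -> R) (psi : U -> R) :
  (forall k u v, V u -> V v -> V (k *: u + v)) ->
  (forall i, lin_on V (phi i)) -> lin_on V psi ->
  (forall u, V u -> (forall i, phi i u = 0) -> psi u = 0) ->
  exists c : 'I_n -> R, forall u, V u -> psi u = \sum_(i < n) c i * phi i u.
Proof.
elim: n V phi => [|n IH] V phi Vlin phil psil ker.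
  exists (fun=> 0) => u Vu; rewrite big_ord0; apply: ker => //; by case.
pose V' := V `&` [set u | phi ord0 u = 0].
have [||||c cP] := IH V' (fun i => phi (lift ord0 i)).
- move=> k u v [Vu /= u0] [Vv /= v0]; split; first exact: Vlin.
  by rewrite /= phil// u0 v0 mulr0 addr0.
- by move=> i k u v [Vu _] [Vv _]; exact: phil.
- by move=> k u v [Vu _] [Vv _]; exact: psil.
- move=> u [Vu /= u0] uP; apply: ker => // i.
  by case: (unliftP ord0 i) => [j|] -> //; exact: uP.
have [[u0 [Vu0 u00]]|none] := pselect (exists u0, V u0 /\ phi ord0 u0 != 0); last first.
  exists (fun i => oapp c 0 (unlift ord0 i)) => u Vu.
  rewrite big_ord_recl unlift_none/= mul0r add0r.
  rewrite (eq_bigr (fun i => c i * phi (lift ord0 i) u));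
  last by move=> i _; rewrite liftK.
  apply: cP; split => //=; apply: contrapT => /eqP u0; apply: none; by exists u.
pose a i := phi i u0 / phi ord0 u0.
exists (fun i => oapp c (psi u0 / phi ord0 u0 -
   \sum_(i < n) c i * a (lift ord0 i)) (unlift ord0 i)) => u Vu.
rewrite big_ord_recl unlift_none/=.
rewrite [X in _ = _ + X](eq_bigr (fun i => c i * phi (lift ord0 i) u));
  last by move=> i _; rewrite liftK.
(* With this [k], the vector [k *: u0 + u] lies in the kernel of the first form, where the induction
   hypothesis applies. *)
pose k := - (phi ord0 u / phi ord0 u0).
have H : k * psi u0 + psi u =
    \sum_(i < n) c i * (k * phi (lift ord0 i) u0 + phi (lift ord0 i) u).
  rewrite -psil// cP; last first.
    by split; [exact: Vlin|rewrite /= phil// /k; field].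
  by apply: eq_bigr => i _; rewrite phil.
have -> : psi u = - (k * psi u0) + (k * psi u0 + psi u) by ring.
have -> : \sum_(i < n) c i * a (lift ord0 i) =
    (\sum_(i < n) c i * phi (lift ord0 i) u0) / phi ord0 u0.
  by rewrite mulr_suml; apply: eq_bigr => i _; rewrite mulrA.
have -> : k * psi u0 + psi u = k * (\sum_(i < n) c i * phi (lift ord0 i) u0) +
    \sum_(i < n) c i * phi (lift ord0 i) u.
  by rewrite H mulr_sumr -big_split; apply: eq_bigr => i _ /=; ring.
by rewrite /k; field.
Qed.

End common_kernel.

(** * Almost everywhere convergence and Fatou's lemma *)

Section limits_ae.
Context {d} {T : measurableType d} {R : realType} (mu : probability T R).

(** By monotone convergence the sum of the series has integral at most [M], so it is finite almost
    everywhere and bounds the nondecreasing partial sums. *)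
Lemma ae_cvg_series (D : nat -> T -> R) (M : R) :
  (forall n, rint mu (D n)) -> (forall n x, 0 <= D n x) ->
  (forall n, \sum_(i < n) \int[mu]_x D i x <= M) ->
  {ae mu, forall x, cvgn (series (fun n => D n x))}.
Proof.
move=> rD D0 DM.
have mD n : measurable_fun setT (fun x => (D n x)%:E).
  by apply/measurable_EFinP; exact: rint_measurable (rD n).
have ED0 n x : setT x -> (0 <= (D n x)%:E)%E by rewrite lee_fin.
have S0 x : (0 <= \sum_(n <oo) (D n x)%:E)%E.
  by apply: nneseries_ge0 => n _ _; rewrite lee_fin.
have intS : mu.-integrable setT (fun x => (\sum_(n <oo) (D n x)%:E)%E).
  apply/integrableP; split.
    apply: ge0_emeasurable_sum => // n x _ _; exact: ED0.
  under eq_integral do rewrite gee0_abs//.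
  rewrite integral_nneseries//; apply: (@le_lt_trans _ _ M%:E); last exact: ltry.
  apply: lime_le.
    by apply: is_cvg_nneseries => n _ _; apply: integral_ge0 => x _; exact: ED0.
  apply: nearW => n; rewrite big_mkord.
  under eq_bigr do rewrite (Rintegral_EFin mu)//.
  by rewrite sumEFin lee_fin.
have := integrable_ae measurableT intS; apply: filterS => x /(_ I) fx.
apply: nondecreasing_is_cvgn.
  by apply/nondecreasing_seqP => n; rewrite !seriesEnat/= big_nat_recr//= lerDl.
exists (fine (\sum_(n <oo) (D n x)%:E)%E) => _ [n _ <-].
rewrite -lee_fin fineK// seriesEnat/= -sumEFin.
by apply: nneseries_lim_ge => i _ _; exact: ED0.
Qed.

(** Fatou's lemma for real integrals. Integrability of the limit is part of the conclusion, because
    [Rintegral] alone would not reveal an infinite integral. *)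
Lemma Rintegral_fatou (k_ : nat -> T -> R) (k : T -> R) (l : R) :
  (forall n, rint mu (k_ n)) -> (forall n x, 0 <= k_ n x) ->
  measurable_fun setT k -> (forall x, 0 <= k x) ->
  {ae mu, forall x, k_ n x @[n --> \oo] --> k x} ->
  \int[mu]_x k_ n x @[n --> \oo] --> l ->
  rint mu k /\ \int[mu]_x k x <= l.
Proof.
move=> rk_ k_0 mk k0 kk kl.
have mk_ n : measurable_fun setT (fun x => (k_ n x)%:E).
  by apply/measurable_EFinP; exact: rint_measurable (rk_ n).
have H : (\int[mu]_x (k x)%:E <= l%:E)%E.
  have := @fatou _ _ _ mu _ measurableT (fun n x => (k_ n x)%:E) mk_.
  have -> : limn_einf (fun n => \int[mu]_x (k_ n x)%:E)%E = l%:E.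
    apply: (cvg_limn_einf_sup _).1.
    under eq_fun do rewrite (Rintegral_EFin mu)//.
    by apply: cvg_EFin => //; exact: nearW.
  move=> F; apply: le_trans (F _); last by move=> n x _; rewrite lee_fin.
  apply: ae_ge0_le_integral => //.
  - by move=> x _; rewrite lee_fin.
  - exact/measurable_EFinP.
  - move=> x _; rewrite limn_einf_lim; apply: lime_ge; first exact: is_cvg_einfs.
    apply: nearW => n; apply: le_ereal_inf_tmp => _ [m _ <-].
    by rewrite lee_fin.
  (* Measurability of the lower limit is obtained from that of the upper limit of the opposites. *)
  - rewrite (_ : (fun _ => _) = (fun x => - limn_esup (fun n => - (k_ n x)%:E))%E).
      apply: measurableT_comp => //; apply: measurable_fun_limn_esup => n.
      exact: measurableT_comp.
    apply/funext => x; rewrite -limn_einfN; congr limn_einf.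
    by apply/funext => n; rewrite [RHS]/= opprK.
  - apply: filterS kk => x kx _.
    have /cvg_limn_einf_sup[-> _] : (k_ n x)%:E @[n --> \oo] --> (k x)%:E.
      by apply: cvg_EFin => //; exact: nearW.
    by [].
have rk : rint mu k by apply: ge0_rint => //; apply: le_lt_trans H _; exact: ltry.
by split => //; rewrite -lee_fin -(Rintegral_EFin mu).
Qed.

End limits_ae.

(** At [t = - A s] the expression equals [A^2 s (s B - 1)], which is negative for small [s > 0]
    unless [A = 0]. *)
Lemma quadratic_ge0_lin0 (R : realFieldType) (A B m : R) : 0 < m ->
  (forall t, `|t| <= m -> 0 <= t * A + t ^+ 2 * B) -> A = 0.
Proof.
move=> m0 H; apply: contrapT => /eqP A0.
have nA : 0 < `|A| by rewrite normr_gt0.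
have B0 : 0 < `|B| + 1 by rewrite ltr_wpDl.
(* This [s] meets both requirements at once: [s |A| <= m] makes [t] admissible, and
   [s (|B| + 1) <= 1 / 2] makes [s B - 1] negative. *)
pose s := m / (2 * m * (`|B| + 1) + `|A|).
have D0 : 0 < 2 * m * (`|B| + 1) + `|A| by rewrite addr_gt0 ?mulr_gt0.
have s0 : 0 < s by rewrite divr_gt0.
have sA : s * `|A| <= m.
  rewrite /s mulrAC ler_pdivrMr// ler_pM2l// lerDr ltW//.
  by rewrite !mulr_gt0.
have sB : s * (`|B| + 1) <= 2^-1.
  rewrite /s mulrAC ler_pdivrMr// [leRHS]mulrDr.
  have -> : 2^-1 * (2 * m * (`|B| + 1)) = m * (`|B| + 1) by field.
  by rewrite lerDl ltW// mulr_gt0.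
have := H (- (A * s)); rewrite normrN normrM (gtr0_norm s0) mulrC.
move=> /(_ sA); have -> : - (A * s) * A + (- (A * s)) ^+ 2 * B =
  A ^+ 2 * s * (s * B - 1) by ring.
rewrite leNgt => /negP; apply; rewrite pmulr_rlt0; last first.
  by rewrite mulr_gt0// exprn_even_gt0.
have : s * B <= s * (`|B| + 1).
  by rewrite ler_pM2l//; apply: le_trans (ler_norm B) _; rewrite lerDl.
lra.
Qed.

(** * Entropy minimization over densities *)

(* [w] plays the role of the moment function [enorm x `^ alpha]. *)
Section entropy_minimization.
Context {d} {T : measurableType d} {R : realType} (mu : probability T R).
Context {p : nat} (F : T -> 'rV[R]_p) (w : T -> R) (C : R).
Hypothesis mF : forall i, measurable_fun setT (fun x => F x 0 i).
Hypothesis mw : measurable_fun setT w.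
Hypothesis w0 : forall x, 0 <= w x.
Hypothesis Fw : forall x i, `|F x 0 i| <= C * (1 + w x).
Implicit Types f g h : T -> R.

Definition pdf f := [/\ measurable_fun setT f, forall x, 0 <= f x, rint mu f &
  \int[mu]_x f x = 1].

Definition feasible f := [/\ pdf f, rint mu (fun x => f x * w x),
  forall i, \int[mu]_x (f x * F x 0 i) = 0 & rint mu (xlnx \o f)].

Definition entropy f := \int[mu]_x xlnx (f x).

Definition minimizer f := feasible f /\ forall g, feasible g -> entropy f <= entropy g.

Lemma rint_constraint f i : pdf f -> rint mu (fun x => f x * w x) ->
  rint mu (fun x => f x * F x 0 i).
Proof.
move=> [mf f0 rf _] rfw.
apply: (@rint_le _ _ _ _ _ (fun x => C * (f x + f x * w x))).
- exact: measurable_funM.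
- move=> x; rewrite normrM ger0_norm//.
  have -> : C * (f x + f x * w x) = f x * (C * (1 + w x)) by ring.
  by rewrite ler_wpM2l.
- by apply: rintZ; exact: rintD.
Qed.

Definition mix t f g := fun x => (1 - t) * f x + t * g x.

Lemma measurable_xlnx_comp f : measurable_fun setT f -> measurable_fun setT (xlnx \o f).
Proof. by move=> mf; apply: measurableT_comp => //; exact: measurable_xlnx. Qed.

Lemma mix_pdf t f g : 0 <= t <= 1 -> pdf f -> pdf g -> pdf (mix t f g).
Proof.
move=> /andP[t0 t1] [mf f0 rf f1] [mg g0 rg g1].
have s0 : 0 <= 1 - t by rewrite subr_ge0.
split.
- by apply: measurable_funD; exact: measurable_funM.
- by move=> x; rewrite /mix addr_ge0// mulr_ge0.
- by apply: rintD; exact: rintZ.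
- rewrite /mix (RintegralDT mu) ?(RintegralZ mu)//; try exact: rintZ.
  by rewrite f1 g1; ring.
Qed.

Lemma mix_feasible t f g : 0 <= t <= 1 -> feasible f -> feasible g -> feasible (mix t f g).
Proof.
move=> t01 [pf fw fF fe] [pg gw gF ge].
have [mm m0 rm m1] := mix_pdf t _ _ t01 pf pg.
split => //.
- rewrite (_ : (fun _ => _) = (fun x => (1 - t) * (f x * w x) + t * (g x * w x))).
    by apply: rintD; exact: rintZ.
  by apply/funext => x; rewrite /mix; ring.
- move=> i.
  rewrite (_ : (fun _ => _) =
     (fun x => (1 - t) * (f x * F x 0 i) + t * (g x * F x 0 i))); last first.
    by apply/funext => x; rewrite /mix; ring.
  have rf := rint_constraint f i pf fw; have rg := rint_constraint g i pg gw.
  rewrite (RintegralDT mu) ?(RintegralZ mu)//; try exact: rintZ.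
  by rewrite fF gF; ring.
- have [_ f0 _ _] := pf; have [_ g0 _ _] := pg.
  apply: (@rint_between _ _ _ mu _ (fun x => mix t f g x - 1)
    (fun x => (1 - t) * xlnx (f x) + t * xlnx (g x))).
  + exact: measurable_xlnx_comp.
  + by move=> x; rewrite /= xlnx_ge// xlnx_convex.
  + by apply: rintB => //; exact: rint_cst.
  + by apply: rintD; exact: rintZ.
Qed.

(* Mixing a mass [t] of [g] into [f] adds [t ln t] times the mass of [g] on [{f = 0}],
   which dominates every linear term as [t -> 0]. *)
Lemma minimizer_support f g : minimizer f -> feasible g ->
  {ae mu, forall x, f x = 0 -> g x = 0}.
Proof.
move=> [ff fmin] fg.
have [[mf f0 rf f1] _ _ fe] := ff; have [[mg g0 rg g1] _ _ ge] := fg.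
pose G x := if f x == 0 then g x else 0.
have mG : measurable_fun setT G.
  by apply: measurable_fun_ifT => //; exact: measurable_fun_eqr.
have G0 x : 0 <= G x by rewrite /G; case: ifP.
have rG : rint mu G.
  by apply: (@rint_le _ _ _ _ _ g) => // x; rewrite ger0_norm// /G; case: ifP.
have key t : 0 < t <= 1 ->
    entropy f <= (1 - t) * entropy f + t * entropy g + t * ln t * \int[mu]_x G x.
  move=> /andP[t0 t1].
  have t01 : 0 <= t <= 1 by rewrite ltW.
  have fm := mix_feasible t f g t01 ff fg; apply: le_trans (fmin _ fm) _.
  have [_ _ _ me] := fm.
  have r1 : rint mu (fun x => (1 - t) * xlnx (f x)) by exact: rintZ.
  have r2 : rint mu (fun x => t * xlnx (g x)) by exact: rintZ.
  have r3 : rint mu (fun x => t * ln t * G x) by exact: rintZ.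
  have r12 := rintD _ _ _ r1 r2.
  rewrite /entropy -!(RintegralZ mu)// -!(RintegralDT mu)//.
  apply: le_RintegralT => //; first exact: rintD.
  move=> x; rewrite /G; case: eqVneq => [fx0|_]; last first.
    by rewrite mulr0 addr0 xlnx_convex.
  rewrite /mix fx0 mulr0 add0r xlnx0 mulr0 add0r.
  have [->|gx0] := eqVneq (g x) 0; first by rewrite !(mulr0, xlnx0, addr0).
  have gx : 0 < g x by rewrite lt_neqAle eq_sym gx0/=.
  by rewrite /xlnx lnM ?posrE//; lra.
have : \int[mu]_x G x = 0.
  apply/eqP; rewrite eq_le Rintegral_ge0// andbT leNgt; apply/negP.
  set I := \int[mu]_x G x => I0.
  (* At [t = exp (- K)] the term [t ln t I] is [- t (|entropy f - entropy g| + 1)], which outweighs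
     the linear term [t (entropy g - entropy f)] and contradicts [key]. *)
  pose K := (`|entropy f - entropy g| + 1) / I.
  have K0 : 0 <= K by rewrite divr_ge0 ?ltW// ltr_wpDl.
  have := key (expR (- K)); rewrite expR_gt0 expR_le1 oppr_le0 K0 => /(_ isT).
  rewrite expRK -/I; set t := expR _.
  have -> : t * - K * I = - (t * (`|entropy f - entropy g| + 1)).
    by rewrite /K; field; rewrite gt_eqF.
  have t0 : 0 < t by exact: expR_gt0.
  have := ler_norm (- (entropy f - entropy g)); rewrite normrN.
  set A := `|_| => H.
  have : t * (entropy g - entropy f) <= t * A by rewrite ler_pM2l//; lra.
  lra.
move=> /(Rintegral_eq0_ae mu _ rG G0); apply: filterS => x; rewrite /G.
by move=> + fx0; rewrite fx0 eqxx.
Qed.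

Lemma hellinger_entropy f g : feasible f -> feasible g ->
  rint mu (fun x => (Num.sqrt (f x) - Num.sqrt (g x)) ^+ 2 / 2) /\
  \int[mu]_x ((Num.sqrt (f x) - Num.sqrt (g x)) ^+ 2 / 2) <=
    entropy f + entropy g - 2 * entropy (mix 2^-1 f g).
Proof.
move=> ff fg.
have h01 : 0 <= (2^-1 : R) <= 1 by lra.
have [_ _ _ me] := mix_feasible _ _ _ h01 ff fg.
have [[mf f0 rf f1] _ _ fe] := ff; have [[mg g0 rg g1] _ _ ge] := fg.
have rh : rint mu (fun x => xlnx (f x) + xlnx (g x)) by exact: rintD.
have rm : rint mu (fun x => 2 * xlnx (mix 2^-1 f g x)) by exact: rintZ.
have rr := rintB _ _ _ rh rm.
have r1 : rint mu (fun x => (Num.sqrt (f x) - Num.sqrt (g x)) ^+ 2 / 2).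
  apply: rint_le rr => [|x].
    apply: measurable_funM => //; apply: measurable_funX.
    by apply: measurable_funB; exact: (measurableT_comp measurable_sqrtr).
  by rewrite ger0_norm ?divr_ge0 ?sqr_ge0// xlnx_hellinger.
split => //.
rewrite /entropy -(RintegralZ mu)// -(RintegralDT mu)// -(RintegralBT mu)//.
by apply: le_RintegralT => // x; exact: xlnx_hellinger.
Qed.

(** The midpoint of two minimizers is feasible, so the convexity gap of the entropy is at most 0; it
    dominates the Hellinger distance, which therefore vanishes. *)
Lemma minimizer_uniq f g : minimizer f -> minimizer g -> {ae mu, forall x, f x = g x}.
Proof.
move=> [ff fmin] [fg gmin].
have h01 : 0 <= (2^-1 : R) <= 1 by lra.
have fm := mix_feasible _ _ _ h01 ff fg.
have [rh hle] := hellinger_entropy _ _ ff fg.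
have := fmin _ fm; have := gmin _ fm; have := fmin _ fg; have := gmin _ ff => *.
have h0 : forall x, 0 <= (Num.sqrt (f x) - Num.sqrt (g x)) ^+ 2 / 2.
  by move=> x; rewrite divr_ge0// sqr_ge0.
have : \int[mu]_x ((Num.sqrt (f x) - Num.sqrt (g x)) ^+ 2 / 2) = 0.
  by apply/eqP; rewrite eq_le Rintegral_ge0// andbT; lra.
have [[_ f0 _ _] _ _ _] := ff; have [[_ g0 _ _] _ _ _] := fg.
move=> /(Rintegral_eq0_ae mu _ rh h0); apply: filterS => x /eqP.
rewrite mulf_eq0 invr_eq0 pnatr_eq0 orbF sqrf_eq0 subr_eq0 => /eqP sfg.
by rewrite -(sqr_sqrtr (f0 x)) sfg sqr_sqrtr.
Qed.

(** Directions of perturbation: boundedness of [h] keeps [(1 + t h) f] nonnegative for small [t] of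
    either sign. *)
Definition bounded_measurable : set (T -> R) :=
  [set h : T -> R | measurable_fun setT h /\ exists M : R, forall x, `|h x| <= M].

Lemma rint_boundedM h g : bounded_measurable h -> rint mu g -> rint mu (fun x => h x * g x).
Proof.
move=> [mh [M hM]] rg.
apply: (@rint_le _ _ _ _ _ (fun x => M * `|g x|)).
- by apply: measurable_funM => //; exact: rint_measurable rg.
- by move=> x; rewrite normrM ler_wpM2r.
- by apply: rintZ; exact: integrable_norm.
Qed.

Lemma bounded_measurable_lin (k : R) h1 h2 : bounded_measurable h1 -> bounded_measurable h2 ->
  bounded_measurable (k *: h1 + h2).
Proof.
move=> [m1 [M1 b1]] [m2 [M2 b2]]; split.
  by apply: measurable_funD => //; exact: measurable_funM.
exists (`|k| * M1 + M2) => x; apply: le_trans (ler_normD _ _) _.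
by apply: lerD => //; rewrite normrM ler_wpM2l.
Qed.

Lemma lin_on_pairing g : rint mu g ->
  lin_on bounded_measurable (fun h => \int[mu]_x (h x * g x)).
Proof.
move=> rg k h1 h2 b1 b2.
have r1 := rint_boundedM _ _ b1 rg; have r2 := rint_boundedM _ _ b2 rg.
rewrite -(RintegralZ mu)// -(RintegralDT mu)//; last exact: rintZ.
by apply: eq_Rintegral => x _; rewrite mulrDl -mulrA.
Qed.

(* First variation along the feasible densities [(1 + t h) f]. *)
Lemma minimizer_stationary f h : minimizer f -> bounded_measurable h ->
  \int[mu]_x (h x * f x) = 0 ->
  (forall i, \int[mu]_x (h x * (f x * F x 0 i)) = 0) ->
  \int[mu]_x (h x * xlnx (f x)) = 0.
Proof.
move=> [ff fmin] bh hf0 hF0.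
have [pf fw fF fe] := ff; have [mf f0 rf f1] := pf.
have [mh [M0 hM0]] := bh; pose M : R := `|M0| + 1.
have M_gt0 : 0 < M by rewrite ltr_wpDl.
have hM x : `|h x| <= M.
  by rewrite (le_trans (hM0 x))// (le_trans (ler_norm _))// lerDl.
have rhf := rint_boundedM _ _ bh rf.
have rhe := rint_boundedM _ _ bh fe.
have rhhf := rint_boundedM _ _ bh rhf.
(* For [|t| <= 1 / M] the entropy increases by at most [t A + t^2 B], where [A] is the integral to
   be shown null and [B] is that of [h^2 f]. Minimality makes this bound nonnegative. *)
apply: (@quadratic_ge0_lin0 _ _ (\int[mu]_x (h x * (h x * f x))) M^-1).
  by rewrite invr_gt0.
move=> t tM; have {}tM : `|t| <= M^-1 := tM.
have th x : -1 <= t * h x <= 1.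
  rewrite -ler_norml normrM.
  have MN0 : M != 0 by rewrite gt_eqF.
  by rewrite -(mulVf MN0) ler_pM.
pose g x := f x + t * (h x * f x).
have gE x : g x = (1 + t * h x) * f x by rewrite /g; ring.
have g0 x : 0 <= g x by rewrite gE mulr_ge0//; have := th x; lra.
have mg : measurable_fun setT g.
  by apply: measurable_funD => //; apply: measurable_funM => //; exact: measurable_funM.
have rg : rint mu g by apply: rintD => //; exact: rintZ.
have pg : pdf g.
  by split => //; rewrite /g (RintegralDT mu) ?(RintegralZ mu)// ?hf0 ?f1 
     ?mulr0 ?addr0//; exact: rintZ.
(* With [u = 1 + t h], [b] is the upper bound given by [xlnx (u f) = u xlnx f + f xlnx u] and
   [xlnx u <= u (u - 1)]. Its term [t h f] integrates to zero. *)
pose b x := xlnx (f x) + (t * (h x * xlnx (f x)) +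
  (t * (h x * f x) + t ^+ 2 * (h x * (h x * f x)))).
have rb1 := rintZ mu t _ rhe.
have rb2 := rintZ mu t _ rhf.
have rb3 := rintZ mu (t ^+ 2) _ rhhf.
have rb4 := rintD mu _ _ rb2 rb3.
have rb5 := rintD mu _ _ rb1 rb4.
have rb : rint mu b by exact: rintD fe rb5.
have gb x : xlnx (g x) <= b x.
  have -> : b x = (1 + t * h x) * xlnx (f x) + f x * ((1 + t * h x) * (t * h x)).
    by rewrite /b; ring.
  rewrite gE; set u := 1 + t * h x.
  have u0 : 0 <= u by rewrite /u; have := th x; lra.
  have [->|uN0] := eqVneq u 0; first by rewrite !(mul0r, xlnx0, mulr0, addr0).
  have [->|fN0] := eqVneq (f x) 0; first by rewrite !(mul0r, xlnx0, mulr0, addr0).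
  have fx0 : 0 < f x by rewrite lt_neqAle eq_sym fN0 f0.
  have ux0 : 0 < u by rewrite lt_neqAle eq_sym uN0 u0.
  have -> : t * h x = u - 1 by rewrite /u; ring.
  have -> : xlnx (u * f x) = u * xlnx (f x) + f x * xlnx u.
    by rewrite /xlnx lnM ?posrE//; ring.
  by rewrite lerD2l ler_pM2l// xlnx_le.
have fg : feasible g.
  split => //.
  - apply: (@rint_le _ _ _ _ _ (fun x => 2 * (f x * w x))).
    + exact: measurable_funM.
    + move=> x; rewrite ger0_norm ?mulr_ge0// gE mulrA ler_wpM2r//.
      by rewrite ler_wpM2r//; have := th x; lra.
    + exact: rintZ.
  - move=> i; have rfi := rint_constraint f i pf fw.
    have rhfi := rint_boundedM _ _ bh rfi.
    transitivity (\int[mu]_x (f x * F x 0 i + t * (h x * (f x * F x 0 i)))).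
      by apply: eq_Rintegral => x _; rewrite /g; ring.
    rewrite (RintegralDT mu) ?(RintegralZ mu)// ?hF0 ?fF ?mulr0 ?addr0//.
    exact: rintZ.
  - apply: (@rint_between _ _ _ mu _ (fun x => g x - 1) b) => //.
    + exact: measurable_xlnx_comp.
    + by move=> x; rewrite /= xlnx_ge//= gb.
    + by apply: rintB => //; exact: rint_cst.
have := fmin _ fg.
have : entropy g <= \int[mu]_x b x.
  by apply: le_RintegralT => //; case: fg.
rewrite /b !(RintegralDT mu)// !(RintegralZ mu)// hf0 mulr0 add0r -/(entropy f).
lra.
Qed.

(** Testing against the sign of [r] gives a null integral of [|r|]. *)
Lemma rint_pairing_eq0 r : rint mu r ->
  (forall h, bounded_measurable h -> \int[mu]_x (h x * r x) = 0) ->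
  {ae mu, forall x, r x = 0}.
Proof.
move=> rr H.
have mr := rint_measurable mu _ rr.
pose h x : R := if 0 <= r x then 1 else -1.
have bh : bounded_measurable h.
  split; first by apply: measurable_fun_ifT => //; exact: measurable_fun_ler.
  by exists 1 => x; rewrite /h; case: ifP => _; rewrite ?normrN normr1.
have hr x : h x * r x = `|r x|.
  rewrite /h; case: ifPn => [r0|]; first by rewrite mul1r ger0_norm.
  by rewrite -ltNge => r0; rewrite mulN1r ltr0_norm.
have := H _ bh; under eq_Rintegral do rewrite hr.
have rnr : rint mu (fun x => `|r x|) by exact: integrable_norm.
move=> /(Rintegral_eq0_ae mu _ rnr (fun x => normr_ge0 _)).
by apply: filterS => x /eqP; rewrite normr_eq0 => /eqP.
Qed.

(** By stationarity, the pairing with [f ln f] vanishes on the common kernel of the pairings with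
    [f] and the [f F_i], hence is a combination of them. Testing against all bounded [h] turns this
    into an identity almost everywhere, which is divided by [f] where [f] is nonzero. *)
Lemma minimizer_exponential f : minimizer f ->
  exists (c : R) (theta : 'rV[R]_p),
    {ae mu, forall x, f x != 0 -> f x = expR (c - dotp theta (F x))}.
Proof.
move=> fm; have [ff _] := fm.
have [pf fw fF fe] := ff; have [mf f0 rf f1] := pf.
(* Index 0 carries the normalization, the lifted indices carry the moment constraints. *)
pose k (i : 'I_p.+1) x := if unlift ord0 i is Some j then f x * F x 0 j else f x.
have rk i : rint mu (k i).
  by rewrite /k; case: unlift => [j|]//; exact: rint_constraint.
have [||||a aP] := @common_kernel_span R (T -> R) p.+1 bounded_measurable
   (fun i h => \int[mu]_x (h x * k i x)) (fun h => \int[mu]_x (h x * xlnx (f x))).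
- exact: bounded_measurable_lin.
- by move=> i; exact: lin_on_pairing.
- exact: lin_on_pairing fe.
- move=> h bh hk; apply: minimizer_stationary => //.
    by have := hk ord0; rewrite /k unlift_none.
  by move=> i; have := hk (lift ord0 i); rewrite /k liftK.
exists (a ord0), (\row_i - a (lift ord0 i)).
pose r x := xlnx (f x) - \sum_(i < p.+1) a i * k i x.
have rak i : rint mu (fun x => a i * k i x) by exact: rintZ.
have rr : rint mu r by apply: rintB => //; exact: rint_sum.
have : forall h, bounded_measurable h -> \int[mu]_x (h x * r x) = 0.
  move=> h bh; rewrite /r.
  have r1 := rint_boundedM _ _ bh fe.
  have r2 i := rint_boundedM _ _ bh (rak i).
  transitivity (\int[mu]_x (h x * xlnx (f x) - \sum_(i < p.+1) h x * (a i * k i x))).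
    by apply: eq_Rintegral => x _; rewrite mulrBr mulr_sumr.
  rewrite (RintegralBT mu)//; last exact: rint_sum.
  rewrite aP// (Rintegral_sum mu)//; apply/eqP; rewrite subr_eq0; apply/eqP.
  apply: eq_bigr => i _; rewrite -(RintegralZ mu); last exact: rint_boundedM.
  by apply: eq_Rintegral => x _; rewrite mulrCA.
move=> /(rint_pairing_eq0 _ rr); apply: filterS => x.
rewrite /r big_ord_recl {1}/k unlift_none => /eqP; rewrite subr_eq0 => /eqP rx fx0.
have fx : 0 < f x by rewrite lt_neqAle eq_sym fx0 f0.
rewrite -[LHS]lnK ?posrE//; congr expR.
apply: (mulfI fx0); rewrite -/(xlnx (f x)) rx mulrBr mulrC; congr (_ + _).
rewrite /dotp mulr_sumr -sumrN; apply: eq_bigr => i _.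
by rewrite /k liftK mxE; ring.
Qed.

(** Integrate Young's inequality at [b = - <theta, F> - L]: the exponential becomes the normalized
    Gibbs density, whose unit mass cancels that of [f]. *)
Lemma gibbs_inequality theta f : pdf f -> rint mu (fun x => f x * w x) ->
  rint mu (xlnx \o f) -> rint mu (fun x => expR (- dotp theta (F x))) ->
  - ln (\int[mu]_x expR (- dotp theta (F x))) <=
  entropy f + \sum_i theta 0 i * \int[mu]_x (f x * F x 0 i).
Proof.
move=> pf fw fe rZ; have [mf f0 rf f1] := pf.
set Z := \int[mu]_x _; set L := ln Z.
(* A null [Z] would force the nowhere vanishing exponential to be 0 almost everywhere, although [mu]
   has mass 1. *)
have Z0 : 0 < Z.
  rewrite lt_neqAle Rintegral_ge0 ?andbT; last by move=> x _; exact: expR_ge0.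
  apply/eqP => /esym/(Rintegral_eq0_ae mu _ rZ (fun x => expR_ge0 _)) H.
  have : mu setT = 0%E.
    case: H => N [mN N0 H]; apply: subset_measure0 N0 => //.
    by apply: subset_trans H => x _ /= /eqP; rewrite expR_eq0.
  by rewrite probability_setT => -[] /eqP; rewrite oner_eq0.
have rfF i : rint mu (fun x => theta 0 i * (f x * F x 0 i)).
  by apply: rintZ; exact: rint_constraint.
have r1 : rint mu (fun x => L * f x) by exact: rintZ.
have r2 : rint mu (fun x => \sum_i theta 0 i * (f x * F x 0 i)) by exact: rint_sum.
have r3 := rintD mu _ _ fe r2.
have r4 := rintD mu _ _ r3 r1.
have r5 : rint mu (fun x => Z^-1 * expR (- dotp theta (F x))) by exact: rintZ.
have : \int[mu]_x (f x - Z^-1 * expR (- dotp theta (F x))) <=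
  \int[mu]_x (xlnx (f x) + \sum_i theta 0 i * (f x * F x 0 i) + L * f x).
  apply: le_RintegralT => //; first exact: rintB.
  move=> x; have := xlnx_young (f x) (- dotp theta (F x) - L) (f0 x).
  rewrite expRB /L lnK ?posrE// [_ / Z]mulrC mulrBr mulrN.
  have -> : f x * dotp theta (F x) = \sum_i theta 0 i * (f x * F x 0 i).
    by rewrite /dotp mulr_sumr; apply: eq_bigr => i _; ring.
  by rewrite -/L; lra.
rewrite (RintegralBT mu)// (RintegralZ mu)// -/Z f1 mulVf ?gt_eqF//.
rewrite !(RintegralDT mu)// (RintegralZ mu)// (Rintegral_sum mu)// f1.
have -> : \sum_i \int[mu]_x (theta 0 i * (f x * F x 0 i)) =
    \sum_i theta 0 i * \int[mu]_x (f x * F x 0 i).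
  by apply: eq_bigr => i _; rewrite (RintegralZ mu)//; exact: rint_constraint.
rewrite -/(entropy f); lra.
Qed.

(** * Existence of a minimizer under exponential moments *)

Hypothesis rexpw : forall lambda, rint mu (fun x => expR (lambda * (1 + w x))).

Lemma entropy_ge0 f : feasible f -> 0 <= entropy f.
Proof.
move=> [[_ f0 rf f1] _ _ fe].
have r1 : rint mu (fun x => f x - 1) by apply: rintB => //; exact: rint_cst.
apply: le_trans (le_RintegralT mu _ _ r1 fe (fun x => xlnx_ge _ (f0 x))).
by rewrite (RintegralBT mu)// ?f1 ?Rintegral_cstT ?subrr//; exact: rint_cst.
Qed.

(* By [hellinger_entropy], consecutive terms are within [O(2^-n)] in Hellinger distance,
   so the increments of the square roots are almost everywhere summable. *)
Lemma minimizing_sequence_cvg (f_ : nat -> T -> R) (v : R) :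
  (forall n, feasible (f_ n)) -> (forall g, feasible g -> v <= entropy g) ->
  (forall n, entropy (f_ n) <= v + 4^-1 ^+ n) ->
  {ae mu, forall x, cvgn (fun n => f_ n x)}.
Proof.
move=> ff vmin fv.
pose D n x := `|Num.sqrt (f_ n.+1 x) - Num.sqrt (f_ n x)|.
pose h n x := (Num.sqrt (f_ n.+1 x) - Num.sqrt (f_ n x)) ^+ 2 / 2.
(* A weighted arithmetic-geometric inequality: the weight [2 ^+ n] trades the square of the
   increment, controlled at rate [4^-n], for the increment itself at rate [2^-n]. *)
have Dle n x : D n x <= 2^-1 ^+ n + 2 ^+ n * 2 * h n x.
  rewrite /h -real_normK ?num_real// -/(D n x).
  have -> : 2 ^+ n * 2 * (D n x ^+ 2 / 2) = 2 ^+ n * D n x ^+ 2 by field.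
  have q0 : (0 : R) < 2 ^+ n by rewrite exprn_gt0.
  rewrite exprVn -(ler_pM2l q0) mulrDr divff ?gt_eqF//.
  have := sqr_ge0 (2 ^+ n * D n x - 2^-1); nra.
have [h01 h02] : 0 <= (2^-1 : R) /\ (2^-1 : R) <= 1 by lra.
have hel n := hellinger_entropy _ _ (ff n.+1) (ff n).
have r1 n : rint mu (fun x => 2 ^+ n * 2 * h n x).
  by apply: rintZ; case: (hel n).
have r2 n : rint mu (fun x => 2^-1 ^+ n + 2 ^+ n * 2 * h n x).
  by apply: rintD => //; exact: rint_cst.
have mf n : measurable_fun setT (f_ n) by case: (ff n) => -[].
have ms n : measurable_fun setT (fun x => Num.sqrt (f_ n x)).
  exact: (measurableT_comp measurable_sqrtr).
have rD n : rint mu (D n).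
  apply: rint_le (r2 n) => [|x]; last by rewrite /D normr_id; exact: Dle.
  by apply: measurableT_comp => //; exact: measurable_funB.
(* The midpoint has entropy at least [v], so the integral of [h n] is at most
   [4^-(n+1) + 4^-n <= 2 * 4^-n]. Multiplied by [2 * 2^n] this is [4 * 2^-n]; the constant term adds
   one more [2^-n]. *)
have ID n : \int[mu]_x D n x <= 5 * 2^-1 ^+ n.
  apply: le_trans (le_RintegralT mu _ _ (rD n) (r2 n) (Dle n)) _.
  have [rh hle] := hel n.
  rewrite (RintegralDT mu) ?Rintegral_cstT ?(RintegralZ mu)//; last exact: rint_cst.
  have := vmin _ (mix_feasible _ _ _ (introT andP (conj h01 h02)) (ff n.+1) (ff n)).
  have := fv n; have := fv n.+1; rewrite exprS.
  set e := 4^-1 ^+ n; set I := \int[mu]_x _ in hle *; rewrite -/entropy in hle *.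
  move=> e1 e2 e3.
  have e0 : 0 <= e by rewrite exprn_ge0.
  have I2 : I <= 2 * e by lra.
  have q0 : (0 : R) < 2 ^+ n by rewrite exprn_gt0.
  have eE : 2 ^+ n * e = 2^-1 ^+ n :> R.
    by rewrite /e -exprMn; congr (_ ^+ _); field.
  have : 2 ^+ n * 2 * I <= 2 ^+ n * 2 * (2 * e) by rewrite ler_pM2l ?mulr_gt0.
  have -> : 2 ^+ n * 2 * (2 * e) = 4 * (2 ^+ n * e) by ring.
  by rewrite eE; lra.
have sumD n : \sum_(i < n) \int[mu]_x D i x <= 10.
  apply: (@le_trans _ _ (10 - 10 * 2^-1 ^+ n)); last first.
    by rewrite lerBlDr lerDl mulr_ge0// exprn_ge0.
  elim: n => [|n IH]; first by rewrite big_ord0 expr0; lra.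
  rewrite big_ord_recr/= exprS; have := ID n; lra.
have := ae_cvg_series mu D _ rD (fun n x => normr_ge0 _) sumD; apply: filterS => x.
move=> /(@normed_cvg _ R^o) /cvg_ex[/= l sl].
(* The absolutely convergent increments telescope to the square roots themselves. *)
have sr : Num.sqrt (f_ n x) @[n --> \oo] --> Num.sqrt (f_ 0%N x) + l.
  rewrite (_ : (fun n => _) = (fun n => Num.sqrt (f_ 0%N x) +
     series (fun n => Num.sqrt (f_ n.+1 x) - Num.sqrt (f_ n x)) n)); last first.
    by apply/funext => n; rewrite [LHS](eq_sum_telescope (fun n => Num.sqrt (f_ n x))).
  by apply: cvgD => //; exact: cvg_cst.
apply/cvg_ex; exists ((Num.sqrt (f_ 0%N x) + l) ^+ 2).
rewrite (_ : (fun n => _) = (fun n => Num.sqrt (f_ n x) * Num.sqrt (f_ n x))).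
  by rewrite expr2; exact: cvgM.
by apply/funext => n; rewrite -expr2 sqr_sqrtr//; case: (ff n) => -[].
Qed.

Lemma rint_expR_bounded (G : T -> R) (K lambda : R) : measurable_fun setT G ->
  (forall x, `|G x| <= K * (1 + w x)) -> 0 <= lambda ->
  rint mu (fun x => expR (lambda * G x)).
Proof.
move=> mG GK l0; apply: rint_le (rexpw (lambda * K)) => [|x].
  by apply: measurableT_comp => //; exact: measurable_funM.
rewrite ger0_norm ?expR_ge0// ler_expR -mulrA ler_wpM2l//.
exact: le_trans (ler_norm _) (GK x).
Qed.

(** * Limits of feasible densities with convergent entropies *)

Section minimizing_limit.
Context (f_ : nat -> T -> R) (f : T -> R) (v : R).
Hypothesis ff_ : forall n, feasible (f_ n).
Hypothesis f_v : entropy (f_ n) @[n --> \oo] --> v.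
Hypothesis mf : measurable_fun setT f.
Hypothesis f0 : forall x, 0 <= f x.
Hypothesis f_f : {ae mu, forall x, f_ n x @[n --> \oo] --> f x}.

(* Nonnegative by [xlnx_young]. *)
Let deficit (lambda : R) (G g : T -> R) x :=
  xlnx (g x) - g x - lambda * (g x * G x) + expR (lambda * G x).

(** All [f_ n] share the mass 1 and the moment [m], so the integrals of their deficits vary only
    through the entropy and converge to the right-hand side. Fatou's lemma then applies. *)
Lemma young_fatou (G : T -> R) (K m lambda : R) : measurable_fun setT G ->
  (forall x, `|G x| <= K * (1 + w x)) -> 0 <= lambda ->
  (forall n, rint mu (fun x => f_ n x * G x)) ->
  (forall n, \int[mu]_x (f_ n x * G x) = m) ->
  rint mu (deficit lambda G f) /\
  \int[mu]_x deficit lambda G f x <=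
    v - 1 - lambda * m + \int[mu]_x expR (lambda * G x).
Proof.
move=> mG GK l0 rG IG.
have rE := rint_expR_bounded G K lambda mG GK l0.
have rf_ n : rint mu (f_ n) by case: (ff_ n) => -[].
have f_0 n x : 0 <= f_ n x by case: (ff_ n) => -[].
have re n : rint mu (xlnx \o f_ n) by case: (ff_ n).
have r1 n : rint mu (fun x => xlnx (f_ n x) - f_ n x) by exact: rintB (re n) (rf_ n).
have r2 n : rint mu (fun x => lambda * (f_ n x * G x)) by exact: rintZ.
have r3 n := rintB mu _ _ (r1 n) (r2 n).
have d0 g x : 0 <= g x -> 0 <= deficit lambda G g x.
  by move=> g0; rewrite /deficit; have := xlnx_young _ (lambda * G x) g0; lra.
apply: (@Rintegral_fatou _ _ _ mu (fun n => deficit lambda G (f_ n))).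
- by move=> n; exact: rintD (r3 n) rE.
- by move=> n x; exact: d0.
- apply: measurable_funD; last first.
    by apply: measurableT_comp => //; exact: measurable_funM.
  apply: measurable_funB; last by apply: measurable_funM => //; exact: measurable_funM.
  by apply: measurable_funB => //; exact: measurable_xlnx_comp.
- by move=> x; exact: d0.
- apply: filterS f_f => x fx; apply: cvgD; last exact: cvg_cst.
  apply: cvgB; last by apply: cvgM; [exact: cvg_cst|apply: cvgM => //; exact: cvg_cst].
  by apply: cvgB => //; exact: cvg_xlnx.
- under eq_fun => n.
    rewrite (RintegralDT mu _ _ (r3 n) rE) (RintegralBT mu _ _ (r1 n) (r2 n)).
    rewrite (RintegralBT mu _ _ (re n) (rf_ n)) (RintegralZ mu)// IG.
    have [[_ _ _ ->] _ _ _] := ff_ n.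
    over.
  apply: cvgD; last exact: cvg_cst.
  apply: cvgB; last exact: cvg_cst.
  by apply: cvgB; last exact: cvg_cst.
Qed.

(* [young_fatou] bounds [m - \int f G] by [O(1 / lambda)]; using it for [G] and [- G]
   replaces a uniform integrability argument. *)
Lemma limit_feasible : feasible f /\ entropy f <= v.
Proof.
have rf_ n : rint mu (f_ n) by case: (ff_ n) => -[].
(* Young's inequality at [b = h] gives [f |g| <= xlnx f - f + exp h]. *)
have young_dom (g h : T -> R) : measurable_fun setT g -> (forall x, `|g x| <= h x) ->
    rint mu (fun x => xlnx (f x) - f x) -> rint mu (fun x => expR (h x)) ->
    rint mu (fun x => f x * g x).
  move=> mg gh r1 r2.
  apply: rint_le (rintD mu _ _ r1 r2) => [|x]; first exact: measurable_funM.
  rewrite normrM ger0_norm//; apply: le_trans (xlnx_young _ _ (f0 x)).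
  exact: ler_wpM2l.
have w1 x : 1 <= 1 + w x by rewrite lerDl.
have one_le x : `|1 : R| <= 1 * (1 + w x) by rewrite normr1 mul1r.
(* At [lambda = 0] the deficit is [xlnx f - f + 1]. *)
have r1 : rint mu (fun x => xlnx (f x) - f x).
  have [||||] := young_fatou (fun=> 1) 1 1 0 _ one_le; rewrite ?lexx//.
  - by move=> n; rewrite (_ : (fun _ => _) = f_ n)//; apply/funext => x; rewrite mulr1.
  - move=> n; under eq_Rintegral do rewrite mulr1.
    by case: (ff_ n) => -[].
  move=> rk _; rewrite (_ : (fun _ => _) = fun x => deficit 0 (fun=> 1) f x - 1).
    by apply: rintB => //; exact: rint_cst.
  by apply/funext => x; rewrite /deficit !mul0r expR0; ring.
have rfG (G : T -> R) (K : R) : measurable_fun setT G ->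
    (forall x, `|G x| <= K * (1 + w x)) -> rint mu (fun x => f x * G x).
  by move=> mG GK; exact: young_dom GK r1 (rexpw K).
have rf : rint mu f.
  rewrite (_ : f = fun x => f x * 1); first exact: (rfG _ 1).
  by apply/funext => x; rewrite mulr1.
have re : rint mu (xlnx \o f).
  rewrite (_ : xlnx \o f = fun x => xlnx (f x) - f x + f x); first exact: rintD.
  by apply/funext => x /=; ring.
(* Once every term is known to be integrable, the integral of [exp (lambda G)] cancels from both
   sides of [young_fatou]. *)
have bound (G : T -> R) (K m lambda : R) : measurable_fun setT G ->
    (forall x, `|G x| <= K * (1 + w x)) -> 0 <= lambda ->
    (forall n, rint mu (fun x => f_ n x * G x)) ->
    (forall n, \int[mu]_x (f_ n x * G x) = m) ->
    entropy f - \int[mu]_x f x - lambda * \int[mu]_x (f x * G x) <= v - 1 - lambda * m.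
  move=> mG GK l0 rG IG.
  have [rk] := young_fatou G K m lambda mG GK l0 rG IG.
  have rE := rint_expR_bounded G K lambda mG GK l0.
  have r2 := rfG G K mG GK.
  have r2' : rint mu (fun x => lambda * (f x * G x)) by exact: rintZ.
  rewrite (RintegralDT mu)//; last exact: rintB.
  by rewrite (RintegralBT mu)// (RintegralBT mu)// (RintegralZ mu)// 
    -[entropy f]/(\int[mu]_x xlnx (f x)); lra.
have half (G : T -> R) (K m : R) : measurable_fun setT G ->
    (forall x, `|G x| <= K * (1 + w x)) ->
    (forall n, rint mu (fun x => f_ n x * G x)) ->
    (forall n, \int[mu]_x (f_ n x * G x) = m) -> m <= \int[mu]_x (f x * G x).
  move=> mG GK rG IG; rewrite leNgt; apply/negP => lt.
  set I := \int[mu]_x (f x * G x) in lt.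
  pose a := v - 1 - (entropy f - \int[mu]_x f x).
  (* [bound] says [lambda (m - I) <= a] for every [lambda >= 0]; this [lambda] makes the left side
     [|a| + 1]. *)
  have := bound G K m ((`|a| + 1) / (m - I)) mG GK _ rG IG.
  rewrite -/I divr_ge0 ?subr_ge0 ?(ltW lt)// ?addr_ge0// => /(_ isT).
  have mI : m - I != 0 by rewrite subr_eq0 gt_eqF.
  have : (`|a| + 1) / (m - I) * (m - I) = `|a| + 1 by field.
  have := ler_norm a; rewrite {1}/a; lra.
have full (G : T -> R) (K m : R) : measurable_fun setT G ->
    (forall x, `|G x| <= K * (1 + w x)) ->
    (forall n, rint mu (fun x => f_ n x * G x)) ->
    (forall n, \int[mu]_x (f_ n x * G x) = m) -> \int[mu]_x (f x * G x) = m.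
  move=> mG GK rG IG; apply/eqP; rewrite eq_le (half G K m mG GK rG IG) andbT.
  have NE (g : T -> R) : (fun x => g x * (-1 * G x)) = (fun x => -1 * (g x * G x)).
    by apply/funext => x; ring.
  have := half (fun x => -1 * G x) K (- m) _ _ _ _.
  rewrite NE (RintegralZ mu); last exact: rfG mG GK.
  rewrite mulN1r lerN2; apply.
  - exact: measurable_funM.
  - by move=> x; rewrite mulN1r normrN.
  - by move=> n; rewrite NE; exact: rintZ.
  - by move=> n; rewrite NE (RintegralZ mu)// IG mulN1r.
have f1 : \int[mu]_x f x = 1.
  rewrite -(full (fun=> 1) 1 1) //.
  - by apply: eq_Rintegral => x _; rewrite mulr1.
  - by move=> n; rewrite (_ : (fun _ => _) = f_ n)//; apply/funext => x; rewrite mulr1.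
  - move=> n; under eq_Rintegral do rewrite mulr1.
    by case: (ff_ n) => -[].
split.
  split => //.
  - by apply: (rfG _ 1) => // x; rewrite ger0_norm// mul1r lerDr.
  - move=> i; apply: (full _ C) => //.
    + by move=> n; case: (ff_ n) => pf fw _ _; exact: rint_constraint.
    + by move=> n; case: (ff_ n).
(* With unit mass established, [lambda = 0] leaves exactly [entropy f <= v]. *)
have := bound (fun=> 1) 1 1 0 _ one_le.
rewrite !mul0r f1 !subr0 lerD2r; apply => //.
- by move=> n; rewrite (_ : (fun _ => _) = f_ n)//; apply/funext => x; rewrite mulr1.
- move=> n; under eq_Rintegral do rewrite mulr1.
  by case: (ff_ n) => -[].
Qed.

End minimizing_limit.

Lemma exists_minimizer : (exists f, feasible f) -> exists f, minimizer f.
Proof.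
move=> [g fg].
pose S : set R := [set entropy f | f in feasible].
have lS : has_lbound S by exists 0 => _ [f ff <-]; exact: entropy_ge0.
have iS : has_inf S by split => //; exists (entropy g), g.
have vmin f : feasible f -> inf S <= entropy f.
  by move=> ff; apply: ge_inf => //; exists f.
have /choice[f_ f_P] : forall n, exists f, feasible f /\ entropy f <= inf S + 4^-1 ^+ n.
  move=> n; have [||_ [f ff <-] /ltW fle] := @inf_adherent _ S (4^-1 ^+ n) => //.
  by exists f.
have ff_ n : feasible (f_ n) := (f_P n).1.
(* An everywhere defined measurable candidate: [fine] sends infinite values to 0 and the absolute
   value ensures nonnegativity. It agrees with the limit wherever the sequence converges. *)
pose f x := `|fine (limn_esup (fun n => (f_ n x)%:E))|.
have mf_ n : measurable_fun setT (f_ n) by case: (ff_ n) => -[].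
have [||||ff fv] := @limit_feasible f_ f (inf S) ff_.
- apply: (@squeeze_cvgr _ _ _ _ (fun=> inf S) (fun n => inf S + 4^-1 ^+ n)).
  + by apply: nearW => n; rewrite vmin//=; case: (f_P n).
  + exact: cvg_cst.
  + rewrite -[X in _ --> X]addr0; apply: cvgD; first exact: cvg_cst.
    by apply: cvg_expr; rewrite ger0_norm//; lra.
- apply: measurableT_comp => //; apply: measurableT_comp => //.
  by apply: measurable_fun_limn_esup => n; exact/measurable_EFinP.
- by move=> x; exact: normr_ge0.
- have := minimizing_sequence_cvg f_ (inf S) ff_ vmin (fun n => (f_P n).2).
  apply: filterS => x /cvg_ex[/= l f_l].
  have l0 : 0 <= l.
    by apply: (cvgr_to_ge f_l); apply: nearW => n; case: (ff_ n) => -[].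
  rewrite /f (cvg_limn_einf_sup (_ : (f_ n x)%:E @[n --> \oo] --> l%:E)).2.
    by rewrite /= ger0_norm.
  by apply: cvg_EFin => //; exact: nearW.
by exists f; split => // h /vmin; apply: le_trans.
Qed.

End entropy_minimization.

(** * Probability measures and their densities *)

Lemma measurable_lne (R : realType) : measurable_fun setT (@lne R).
Proof.
rewrite (_ : @lne R = fun y => if (y <= 0)%E then -oo%E else
    if y == +oo%E then +oo%E else (ln (fine y))%:E); last first.
  by apply/funext => -[r| |] /=; rewrite ?lee_fin// leNye.
apply: measurable_fun_ifT => //; last first.
  apply: measurable_fun_ifT => //.
    apply: (measurable_fun_bool true).
    rewrite setTI (_ : _ @^-1` _ = [set +oo%E])//.
    by apply/seteqP; split => x /eqP.
  by apply/measurable_EFinP; exact: measurableT_comp.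
apply: (measurable_fun_bool true).
rewrite setTI (_ : _ @^-1` _ = [set` `]-oo, 0%E]%O]); first exact: emeasurable_itv.
by apply/seteqP; split => x /=; rewrite in_itv.
Qed.

Section density_probability.
Context {d} {T : measurableType d} {R : realType} (mu : probability T R).
Variables (f : T -> R) (pf : pdf mu f).

(* The proof is an argument so that the instances below are keyed on it. *)
Definition density_prob (_ : pdf mu f) (A : set T) : \bar R :=
  (\int[mu]_(x in A) (f x)%:E)%E.

Let density_prob0 : density_prob pf set0 = 0%E.
Proof. by rewrite /density_prob integral_set0. Qed.

Let density_prob_ge0 A : (0 <= density_prob pf A)%E.
Proof. by have [_ f0 _ _] := pf; apply: integral_ge0 => x _; rewrite lee_fin. Qed.

Let density_prob_sigma_additive : semi_sigma_additive (density_prob pf).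
Proof.
have [_ f0 rf _] := pf.
move=> /= A mA tA mUA; rewrite /density_prob/= integral_bigcup//=; last first.
  by apply: (integrableS _ _ (subsetT _)).
apply: is_cvg_ereal_nneg_natsum_cond => n _ _.
by apply: integral_ge0 => /= x ?; rewrite lee_fin.
Qed.

HB.instance Definition _ := isMeasure.Build _ _ _
  (density_prob pf) density_prob0 density_prob_ge0 density_prob_sigma_additive.

Let density_prob_setT : density_prob pf setT = 1%E.
Proof. by have [_ _ rf f1] := pf; rewrite /density_prob (Rintegral_EFin mu)// f1. Qed.

HB.instance Definition _ :=
  @Measure_isProbability.Build _ _ R (density_prob pf) density_prob_setT.

End density_probability.

Section density_of_probability.
Context {d} {T : measurableType d} {R : realType} (mu : probability T R).
Implicit Types (pi : probability T R) (f : T -> R).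

(** Stated on measurable sets so that a real-valued, everywhere nonnegative representative can be
    used in place of the extended-real [dens], with which it agrees only almost everywhere. *)
Definition is_density pi f :=
  forall A, measurable A -> pi A = (\int[mu]_(x in A) (f x)%:E)%E.

Lemma exists_density_prob f : pdf mu f -> exists pi, is_density pi f.
Proof. by move=> pf; exists (density_prob mu f pf). Qed.

Lemma dominates_density pi : pi `<< mu -> exists2 f, pdf mu f & is_density pi f.
Proof.
move=> pimu; have [f [f0 ffin intf fE]] := radon_nikodym_sigma_finite pimu.
have finef x : (fine (f x))%:E = f x by rewrite fineK.
have rf : rint mu (fine \o f).
  by rewrite /rint (_ : _ \o _ = f)//; apply/funext => x /=; rewrite finef.
have pE A : measurable A -> pi A = (\int[mu]_(x in A) (fine (f x))%:E)%E.
  by move=> mA; rewrite fE//; apply: eq_integral => x _; rewrite finef.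
exists (fine \o f) => //; split => //.
- exact: rint_measurable rf.
- by move=> x; apply: fine_ge0.
- by rewrite /Rintegral -pE// probability_setT.
Qed.

Section fixed_density.
Context (pi : probability T R) (f : T -> R).
Hypotheses (pf : pdf mu f) (pif : is_density pi f).

Lemma density_dominates : pi `<< mu.
Proof.
have [mf _ _ _] := pf.
apply/null_content_dominatesP => A mA A0; rewrite pif//.
by apply: null_set_integral => //; apply/measurable_funTS/measurable_EFinP.
Qed.

Lemma dens_ae : {ae mu, forall x, dens pi mu x = (f x)%:E}.
Proof.
have [mf _ rf _] := pf.
have pimu := density_dominates.
have := @integral_ae_eq _ _ _ mu setT measurableT (EFin \o f) (dens pi mu).
move=> /(_ _ _ _)/wrap[].
- exact: Radon_Nikodym_integrable.
- exact/measurable_EFinP.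
- by move=> A _ mA; rewrite /dens -Radon_Nikodym_integral// -pif.
by apply: filterS => x /(_ I).
Qed.

Lemma measurable_dens : measurable_fun setT (dens pi mu).
Proof. by apply: measurable_int (Radon_Nikodym_integrable _); exact: density_dominates. Qed.

(** Where [f] vanishes, the product of 0 with [-oo] is 0, in agreement with [xlnx 0 = 0]. *)
Lemma KL_density : KL pi mu = (\int[mu]_x (xlnx (f x))%:E)%E.
Proof.
have [mf f0 rf _] := pf; have pimu := density_dominates.
rewrite /KL asboolT//; apply: ae_eq_integral => //.
- have md := measurable_dens.
  by apply: emeasurable_funM => //; apply: measurableT_comp => //; exact: measurable_lne.
- by apply/measurable_EFinP; exact: measurable_xlnx_comp.
- apply: filterS dens_ae => x -> _ /=.
  have [fx0|fx0] := leP (f x) 0.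
    have -> : f x = 0 by apply/eqP; rewrite eq_le fx0 f0.
    by rewrite xlnx0 mul0e.
  by rewrite -EFinM.
Qed.

Lemma ge0_integral_density (g : T -> R) : measurable_fun setT g -> (forall x, 0 <= g x) ->
  (\int[pi]_x (g x)%:E = \int[mu]_x (f x * g x)%:E)%E.
Proof.
have [mf f0 rf _] := pf; have pimu := density_dominates.
move=> mg g0.
have E0 x : (0 <= (g x)%:E)%E by rewrite lee_fin.
have mg' : measurable_fun setT (fun x => (g x)%:E) by exact/measurable_EFinP.
rewrite -(Radon_Nikodym_SigmaFinite.change_of_variables pimu E0 measurableT mg').
apply: ae_eq_integral => //.
- apply: emeasurable_funM; first exact/measurable_EFinP.
  exact: measurable_int (Radon_Nikodym_SigmaFinite.f_integrable pimu).
- by apply/measurable_EFinP; exact: measurable_funM.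
have := ae_eq_Radon_Nikodym_SigmaFinite pimu measurableT.
apply: filterS2 dens_ae => x dx /(_ I) -> _.
by rewrite -/(dens pi mu) dx -EFinM mulrC.
Qed.

Lemma rint_density (g : T -> R) : measurable_fun setT g -> rint mu (fun x => f x * g x) ->
  rint pi g.
Proof.
have [mf f0 rf _] := pf.
move=> mg /integrableP[_ foo]; apply/integrableP; split; first exact/measurable_EFinP.
rewrite [ltLHS](ge0_integral_density (fun x => `|g x|))//; last exact: measurableT_comp.
rewrite (eq_integral (fun x => `|(EFin \o (fun x => f x * g x)%R) x|)%E)// => x _ /=.
by rewrite normrM ger0_norm.
Qed.

Lemma Rintegral_density (g : T -> R) : measurable_fun setT g -> rint mu (fun x => f x * g x) ->
  \int[pi]_x g x = \int[mu]_x (f x * g x).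
Proof.
have [mf f0 rf _] := pf; have pimu := density_dominates.
move=> mg rfg; congr fine; have rg := rint_density g mg rfg.
rewrite -(Radon_Nikodym_change_of_variables pimu)//.
apply: ae_eq_integral => //.
- apply: emeasurable_funM; first exact/measurable_EFinP.
  exact: measurable_dens.
- exact: measurable_int rfg.
- by apply: filterS dens_ae => x + _; rewrite /dens => ->; rewrite -EFinM mulrC.
Qed.

Lemma KL_rint : rint mu (xlnx \o f) -> KL pi mu = (entropy mu f)%:E.
Proof. by move=> re; rewrite KL_density (Rintegral_EFin mu). Qed.

(** Since [xlnx u >= u - 1 >= -1], the negative part has integral at most 1, so only the positive
    part could diverge. *)
Lemma KL_lty_rint : (KL pi mu < +oo)%E -> rint mu (xlnx \o f).
Proof.
have [mf f0 rf _] := pf.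
have mx : measurable_fun setT (xlnx \o f) by exact: measurable_xlnx_comp.
have mEx : measurable_fun setT (EFin \o (xlnx \o f)) by exact/measurable_EFinP.
rewrite KL_density => Koo; apply/integrableP; split => //.
rewrite [ltLHS](_ : _ = (\int[mu]_x `|(xlnx (f x))%:E|)%E)// integral_fin_num_abs//.
rewrite fin_numElt Koo andbT integralE.
have neg1 : (\int[mu]_x (fun x => (xlnx (f x))%:E)^\- x <= 1%:E)%E.
  apply: (@le_trans _ _ (\int[mu]_x (cst 1%:E x))%E); last first.
    rewrite (_ : integral _ _ _ = (1%:E * mu setT)%E); last exact: integral_cst.
    by rewrite probability_setT mule1.
  apply: ge0_le_integral => //.
  - exact: measurable_funeneg.
  - move=> x _; rewrite funenegE ge_max -EFinN !lee_fin ler01 andbT.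
    by have := xlnx_ge _ (f0 x); have := f0 x; lra.
have pos0 : (0 <= \int[mu]_x (fun x => (xlnx (f x))%:E)^\+ x)%E.
  by apply: integral_ge0.
apply: (@lt_le_trans _ _ (0 - 1%:E)%E); first by rewrite sub0e ltNye.
exact: leeB.
Qed.

End fixed_density.

End density_of_probability.

(** * Moments and constraints on R^d *)

Section euclidean_borel.
Context {R : realType} {d : nat}.

Lemma continuous_measurable_rV (g : 'rV[R]_d -> R) : continuous g ->
  measurable_fun setT (g : borel_rV R d -> R).
Proof.
move=> /continuousP cg; apply: (measurability _ (RGenOpens.measurableE R)).
move=> _ [_ [a [b ->] <-]]; rewrite setTI; apply: sub_sigma_algebra.
exact/cg/interval_open.
Qed.

Lemma measurable_coordinate {p} {G : 'rV[R]_d -> 'rV[R]_p} : continuous G ->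
  forall i, measurable_fun setT (fun x : borel_rV R d => G x 0 i).
Proof.
move=> cG i; apply: continuous_measurable_rV => x.
by apply: (@continuous_comp _ _ _ G (fun M : 'rV[R]_p => M 0 i));
  [exact: cG|exact: coord_continuous].
Qed.

Lemma enorm_ge0 (u : 'rV[R]_d) : 0 <= enorm u.
Proof. exact: sqrtr_ge0. Qed.

Lemma enorm_continuous : continuous (@enorm R d).
Proof.
move=> u; apply: continuous_comp; last exact: sqrt_continuous.
move: u; apply: (@continuous_big R^o 'I_d _ _ xpredT).
  exact: add_continuous.
by move=> i _ u; apply: continuousM; exact: coord_continuous.
Qed.

Lemma le_coord_enorm (u : 'rV[R]_d) i : `|u 0 i| <= enorm u.
Proof.
rewrite -sqrtr_sqr ler_wsqrtr// /dotp (bigD1 i)//= -expr2 lerDl.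
by apply: sumr_ge0 => j _; rewrite -expr2 sqr_ge0.
Qed.

Lemma measurable_enorm_powR (r : R) :
  measurable_fun setT (fun x : borel_rV R d => enorm x `^ r).
Proof.
have me : measurable_fun setT (@enorm R d : borel_rV R d -> R).
  by apply: continuous_measurable_rV; exact: enorm_continuous.
exact: (measurableT_comp (measurable_powR r) me).
Qed.

(** The higher power wins: [lambda (1 + t^a) <= K + eta t^b] for all [t >= 0], so a single
    exponential moment of order [b] yields all those of order [a]. *)
Lemma rint_expR_powR (mu : probability (borel_rV R d) R) (a b eta lambda : R) :
  0 <= a < b -> 0 < eta ->
  (\int[mu]_x (expR (eta * enorm x `^ b))%:E < +oo)%E ->
  rint mu (fun x => expR (lambda * (1 + enorm x `^ a))).
Proof.
move=> /andP[a0 ab] eta0 foo.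
have mp := measurable_enorm_powR.
have rb : rint mu (fun x => expR (eta * enorm x `^ b)).
  apply: ge0_rint => //.
  by apply: measurableT_comp => //; exact: measurable_funM.
(* Beyond [t0] one has [t^(b - a) >= c], hence [eta t^b >= |lambda| t^a] because
   [eta c >= |lambda|]; below [t0] the constant [K] suffices. The added 1 keeps [c], and so [t0],
   positive. *)
pose c := `|lambda| / eta + 1.
have c1 : 1 <= c by rewrite lerDr divr_ge0// ltW.
have ba : 0 < b - a by rewrite subr_gt0.
pose t0 := c `^ (b - a)^-1.
have t00 : 0 < t0 by rewrite powR_gt0// (lt_le_trans ltr01).
pose K := `|lambda| + `|lambda| * t0 `^ a.
have key t : 0 <= t -> lambda * (1 + t `^ a) <= K + eta * t `^ b.
  move=> t_ge0.
  have ta := powR_ge0 t a; have tb := powR_ge0 t b; have t0a := powR_ge0 t0 a.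
  apply: (@le_trans _ _ (`|lambda| * (1 + t `^ a))).
    by rewrite ler_wpM2r ?ler_norm// addr_ge0.
  rewrite mulrDr mulr1 /K -addrA lerD2l.
  have [tt0|t0t] := leP t t0.
    apply: ler_wpDr; first by rewrite mulr_ge0// ltW.
    by rewrite ler_wpM2l// ge0_ler_powR// nnegrE ltW.
  apply: ler_wpDl; first by rewrite mulr_ge0.
  have t_gt0 : 0 < t by exact: lt_trans t0t.
  have -> : t `^ b = t `^ a * t `^ (b - a).
    by rewrite -powRD ?(gt_eqF t_gt0) ?implybT// addrC subrK.
  rewrite mulrCA [leLHS]mulrC ler_wpM2l//.
  have H : c <= t `^ (b - a).
    have -> : c = t0 `^ (b - a).
      by rewrite /t0 -powRrM mulVf ?gt_eqF// powRr1// (le_trans ler01).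
    by rewrite ge0_ler_powR ?nnegrE// ltW.
  have {}H : eta * c <= eta * t `^ (b - a) by rewrite ler_pM2l.
  apply: le_trans H.
  rewrite /c mulrDr mulrCA divff ?gt_eqF// !mulr1 lerDl; exact: ltW.
apply: rint_le (rintZ mu (expR K) _ rb) => [|x].
  apply: measurableT_comp => //; apply: measurable_funM => //.
  by apply: measurable_funD => //; exact: mp.
by rewrite ger0_norm ?expR_ge0// -expRD ler_expR key// enorm_ge0.
Qed.

End euclidean_borel.

(** * Problems (P) and (Q) in terms of densities *)

Section maximum_entropy_densities.
Context {R : realType} {d p : nat}.
Variables (mu : probability (borel_rV R d) R) (F : 'rV[R]_d -> 'rV[R]_p).
Variables (alpha C : R).
Hypothesis F_cont : continuous F.
Hypothesis F_le : forall x, enorm (F x) <= C * (1 + enorm x `^ alpha).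

Let w (x : borel_rV R d) := enorm x `^ alpha.
Let prob := probability (borel_rV R d) R.
Implicit Types (pi : prob) (f g : borel_rV R d -> R) (theta : 'rV[R]_p).

Let mF := measurable_coordinate F_cont.

Let mw : measurable_fun setT w.
Proof.
exact: measurable_enorm_powR.
Qed.

Let w0 x : 0 <= w x.
Proof. exact: powR_ge0. Qed.

Let Fw (x : borel_rV R d) i : `|F x 0 i| <= C * (1 + w x).
Proof. exact: le_trans (le_coord_enorm _ _) (F_le x). Qed.

Lemma measurable_gibbs theta :
  measurable_fun setT (fun x : borel_rV R d => expR (- dotp theta (F x))).
Proof.
apply: measurableT_comp => //; apply: measurableT_comp => //.
by apply: measurable_sum => i; exact: measurable_funM.
Qed.

Section fixed_density.
Context pi f (pf : pdf mu f) (pif : is_density mu pi f).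

Lemma Palpha_rint : Palpha alpha pi -> rint mu (fun x => f x * w x).
Proof.
have [mf f0 _ _] := pf.
rewrite /Palpha/= (ge0_integral_density mu pi f pf pif w)// => H.
by apply: ge0_rint => //; [exact: measurable_funM|move=> x; exact: mulr_ge0].
Qed.

Lemma rint_Palpha : rint mu (fun x => f x * w x) -> Palpha alpha pi.
Proof.
move=> rw; rewrite /Palpha/= (ge0_integral_density mu pi f pf pif w)//.
by rewrite (Rintegral_EFin mu)// ltry.
Qed.

Lemma mean_density i : rint mu (fun x => f x * w x) ->
  mean F pi 0 i = \int[mu]_x (f x * F x 0 i).
Proof.
move=> rw; rewrite mxE (Rintegral_density mu pi f)//.
exact: (rint_constraint mu F w C mF Fw).
Qed.

Lemma feasible_PFalpha : feasible mu F w f ->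
  PFalpha F alpha pi /\ KL pi mu = (entropy mu f)%:E.
Proof.
move=> [_ rw fF fe]; split; last exact: KL_rint.
split; first exact: rint_Palpha.
by apply/rowP => i; rewrite mean_density// fF mxE.
Qed.

Lemma PFalpha_feasible : PFalpha F alpha pi -> (KL pi mu < +oo)%E -> feasible mu F w f.
Proof.
move=> [Pa m0] Koo; have rw := Palpha_rint Pa.
split => //; last exact: KL_lty_rint pif Koo.
by move=> i; rewrite -mean_density// m0 mxE.
Qed.

End fixed_density.

Lemma KL_lty_density pi : (KL pi mu < +oo)%E ->
  exists2 f, pdf mu f & is_density mu pi f.
Proof.
rewrite /KL; case: ifPn => [/asboolP pimu _|]; last by rewrite ltxx.
exact: dominates_density.
Qed.

Lemma solvesP_minimizer pi f : pdf mu f -> is_density mu pi f ->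
  solvesP mu F alpha pi -> (KL pi mu < +oo)%E -> minimizer mu F w f.
Proof.
move=> pf pif [PFpi pimin] Koo.
have ff := PFalpha_feasible pi f pf pif PFpi Koo; split => // g fg.
have [pg _ _ _] := fg; have [nu nug] := exists_density_prob mu g pg.
have [PFnu Knu] := feasible_PFalpha nu g pg nug fg.
have [_ Kpi] := feasible_PFalpha pi f pf pif ff.
by have := pimin nu PFnu; rewrite Knu Kpi lee_fin.
Qed.

(** Competitors of infinite divergence are harmless, and the others have feasible densities. *)
Lemma minimizer_solvesP pi f : is_density mu pi f -> minimizer mu F w f ->
  solvesP mu F alpha pi.
Proof.
move=> pif [ff fmin]; have [pf _ _ _] := ff.
have [PFpi Kpi] := feasible_PFalpha pi f pf pif ff; split => // nu PFnu.
have [Koo|] := ltP (KL nu mu) +oo%E; last by rewrite leye_eq => /eqP ->; exact: leey.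
have [g pg nug] := KL_lty_density nu Koo.
have fg := PFalpha_feasible nu g pg nug PFnu Koo.
have [_ Knu] := feasible_PFalpha nu g pg nug fg.
by rewrite Kpi Knu lee_fin fmin.
Qed.

Lemma solvesP_vP pi : solvesP mu F alpha pi -> KL pi mu = vP mu F alpha.
Proof.
move=> [PFpi pimin]; apply/eqP; rewrite eq_le; apply/andP; split.
  by apply: le_ereal_inf_tmp => _ [nu PFnu <-]; exact: pimin.
by apply: ereal_inf_lbound; exists pi.
Qed.

Lemma minimizer_feasible_null f : minimizer mu F w f ->
  feasible_null mu F alpha [set x | f x = 0].
Proof.
move=> fm; have [[[mf _ _ _] _ _ _] _] := fm.
have mN : measurable ([set x | f x = 0] : set (borel_rV R d)).
  by rewrite -[X in measurable X]setTI; exact: (mf measurableT [set 0]).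
split => // pi PFpi Koo.
have [g pg pig] := KL_lty_density pi Koo; have [mg _ _ _] := pg.
have fg := PFalpha_feasible pi g pg pig PFpi Koo.
rewrite pig// (ae_eq_integral (cst 0%E))//.
- by rewrite integral0.
- exact/measurable_EFinP/measurable_funTS.
- have := minimizer_support mu F w C mF Fw f g fm fg.
  by apply: filterS => x fgx fx; rewrite fgx.
Qed.

Lemma minimizer_gibbs f : minimizer mu F w f ->
  exists (theta : 'rV[R]_p) (k : R), 0 < k /\
    {ae mu, forall x, f x = if f x == 0 then 0 else k * expR (- dotp theta (F x))}.
Proof.
move=> fm; have [c [theta H]] := minimizer_exponential mu F w C mF mw w0 Fw f fm.
exists theta, (expR c); split; first exact: expR_gt0.
apply: filterS H => x; case: eqVneq => // fx0 /(_ isT) ->.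
by rewrite -expRD.
Qed.

(** Unit mass determines [k]: the integral of the exponential off [N] is [k^-1]. *)
Lemma gibbs_offE f theta (k : R) : pdf mu f -> 0 < k ->
  {ae mu, forall x, f x = if f x == 0 then 0 else k * expR (- dotp theta (F x))} ->
  {ae mu, forall x, f x = gibbs_off mu F [set x | f x = 0] theta x}.
Proof.
move=> pf k0 H; have [mf _ rf f1] := pf.
set N := [set x | f x = 0].
have NE x : (x \in N) = (f x == 0).
  by apply/idP/eqP; [rewrite inE|move=> fx; rewrite inE].
have -> : gibbs_off mu F N theta =
    fun x => if f x == 0 then 0 else k * expR (- dotp theta (F x)).
  have IE : \int[mu]_(y in ~` N) expR (- dotp theta (F y)) = k^-1.
    rewrite Rintegral_mkcond.
    transitivity (\int[mu]_x (k^-1 * f x)); last first.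
      by rewrite (RintegralZ mu)// f1 mulr1.
    have mg : measurable_fun setT (fun x => if f x == 0 then 0 else
        k * expR (- dotp theta (F x))).
      apply: measurable_fun_ifT => //; first exact: measurable_fun_eqr.
      by apply: measurable_funM => //; exact: measurable_gibbs.
    transitivity (\int[mu]_x (k^-1 * if f x == 0 then 0 else
        k * expR (- dotp theta (F x)))).
      apply: eq_Rintegral => x _; rewrite patchE in_setC NE.
      by case: eqP => _ /=; rewrite ?mulr0// mulKf ?gt_eqF.
    apply: (ae_Rintegral_eq mu).
    - exact: measurable_funM.
    - exact: measurable_funM.
    - by apply: filterS H => x <-.
  apply/funext => x; rewrite /gibbs_off IE NE invrK.
  by case: eqP => // _; rewrite mulrC.
exact: H.
Qed.

Lemma density_has_density pi f (h : borel_rV R d -> R) : pdf mu f -> is_density mu pi f ->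
  {ae mu, forall x, f x = h x} -> has_density pi mu h.
Proof.
move=> pf pif fh; split; first exact: density_dominates pif.
by apply: filterS2 fh (dens_ae mu pi f pf pif) => x -> ->.
Qed.

(** This is [gibbs_inequality] for each competitor of finite divergence; the others contribute
    [+oo]. *)
Lemma dual_ge theta : Theta mu F theta -> ((- logZ mu F theta)%:E <= dual mu F alpha theta)%E.
Proof.
move=> Th; apply: le_ereal_inf_tmp => _ [pi Pa <-].
have [Koo|] := ltP (KL pi mu) +oo%E; last first.
  by rewrite leye_eq => /eqP ->; rewrite addye// leey.
have [f pf pif] := KL_lty_density pi Koo.
have fe := KL_lty_rint mu pi f pf pif Koo.
have rw := Palpha_rint pi f pf pif Pa.
rewrite (KL_rint mu pi f)// -EFinD lee_fin.
have rZ : rint mu (fun x => expR (- dotp theta (F x))).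
  by apply: ge0_rint => //; exact: measurable_gibbs.
have := gibbs_inequality mu F w C mF Fw theta f pf rw fe rZ.
congr (_ <= _ + _); apply: eq_bigr => i _.
by rewrite (mean_density pi f).
Qed.

(** Weak duality: the multiplier term vanishes on the constraint set. *)
Lemma dual_le theta pi : PFalpha F alpha pi -> (dual mu F alpha theta <= KL pi mu)%E.
Proof.
move=> [Pa m0]; apply: ereal_inf_lbound; exists pi => //.
rewrite m0 /dotp big1 ?adde0// => i _; by rewrite mxE mulr0.
Qed.

(** Once [{f = 0}] is [mu]-null, [f] is a full exponential density and its entropy is [- logZ], so
    that [dual_ge] and [dual_le] meet and close the duality gap. *)
Lemma solvesP_gibbs pi f theta (k : R) : is_density mu pi f -> minimizer mu F w f ->
  0 < k ->
  {ae mu, forall x, f x = if f x == 0 then 0 else k * expR (- dotp theta (F x))} ->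
  (exists nu : prob, [/\ PFalpha F alpha nu, (KL nu mu < +oo)%E & mu `<< nu]) ->
  [/\ solvesQ mu F alpha theta,
      has_density pi mu (fun x => expR (- dotp theta (F x) - logZ mu F theta)) &
      vQ mu F alpha = vP mu F alpha].
Proof.
move=> pif fm k0 H [nu [PFnu Koo munu]].
have [ff _] := fm; have [pf _ fF fe] := ff; have [mf f0 rf f1] := pf.
have [mN nuN] := minimizer_feasible_null f fm.
(* Every feasible measure of finite divergence ignores [N], in particular [nu], which dominates
   [mu]. *)
have muN : mu [set x | f x = 0] = 0%E.
  by move/null_content_dominatesP : munu; apply => //; exact: nuN.
have {H}fE : {ae mu, forall x, f x = k * expR (- dotp theta (F x))}.
  have Nae : {ae mu, forall x, f x != 0}.
    by exists [set x | f x = 0]; split => // x /= /negP; rewrite negbK => /eqP.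
  by apply: filterS2 H Nae => x fx /negPf fx0; move: fx; rewrite fx0.
have mg := measurable_gibbs theta.
have rZ : rint mu (fun x => expR (- dotp theta (F x))).
  apply: (ae_rint mu (fun x => k^-1 * f x)) => //.
  - exact: measurable_funM.
  - by apply: filterS fE => x ->; rewrite mulKf// gt_eqF.
  - exact: rintZ.
have Th : Theta mu F theta by rewrite /Theta/= (Rintegral_EFin mu)// ltry.
have ZE : \int[mu]_x expR (- dotp theta (F x)) = k^-1.
  transitivity (\int[mu]_x (k^-1 * f x)); last by rewrite (RintegralZ mu)// f1 mulr1.
  apply: (ae_Rintegral_eq mu) => //; first exact: measurable_funM.
  by apply: filterS fE => x ->; rewrite mulKf// gt_eqF.
have LE : logZ mu F theta = - ln k by rewrite /logZ ZE lnV.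
have [PFpi KLE] := feasible_PFalpha pi f pf pif ff.
have KLpi : KL pi mu = (- logZ mu F theta)%:E.
  rewrite KLE LE opprK; congr (_%:E).
  (* This is [f ln f] expanded through [ln f = ln k - <theta, F>]. The constraints annihilate all
     but the first term, leaving [ln k]. *)
  pose g x := ln k * f x + \sum_i (- theta 0 i) * (f x * F x 0 i).
  have rF i : rint mu (fun x => - theta 0 i * (f x * F x 0 i)).
    by apply: rintZ; apply: (rint_constraint mu F w C mF Fw) => //; case: ff.
  have rg1 : rint mu (fun x => ln k * f x) by exact: rintZ.
  have rg2 := rint_sum mu _ _ rF.
  have rg := rintD mu _ _ rg1 rg2.
  transitivity (\int[mu]_x g x).
    apply: (ae_Rintegral_eq mu); [exact: rint_measurable fe|exact: rint_measurable rg|].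
    apply: filterS fE => x fx; rewrite /xlnx /g {2}fx lnM ?posrE ?expR_gt0// expRK.
    rewrite mulrDr mulrC; congr (_ + _).
    by rewrite /dotp -sumrN mulr_sumr; apply: eq_bigr => i _; ring.
  rewrite (RintegralDT mu)// (RintegralZ mu)// f1 mulr1 (Rintegral_sum mu)//.
  rewrite big1 ?addr0// => i _.
  rewrite (RintegralZ mu) ?fF ?mulr0//.
  by apply: (rint_constraint mu F w C mF Fw) => //; case: ff.
have dge := dual_ge theta Th.
have dE : dual mu F alpha theta = KL pi mu.
  by apply/eqP; rewrite eq_le dual_le//= KLpi.
have sQ : solvesQ mu F alpha theta.
  by split => // theta' _; rewrite dE dual_le.
split => //.
- apply: density_has_density pif _ => //.
  apply: filterS fE => x ->.
  by rewrite LE opprK expRD lnK ?posrE// mulrC.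
- rewrite -(solvesP_vP pi); last exact: minimizer_solvesP pif fm.
  apply/eqP; rewrite eq_le; apply/andP; split.
    by apply: ge_ereal_sup => _ [theta' _ <-]; exact: dual_le.
  by rewrite -dE; apply: ereal_sup_ubound; exists theta.
Qed.

End maximum_entropy_densities.

(** * Form, uniqueness and existence of the solution, and duality *)

Theorem proposition3 (R : realType) (d p : nat)
    (mu : probability (borel_rV R d) R) (F : 'rV[R]_d -> 'rV[R]_p)
    (x0 : 'rV[R]_d) (Fx0 : F x0 = 0)
    (alpha : R) (alpha_ge0 : 0 <= alpha)
    (F_cont : continuous F)
    (F_growth : exists2 C : R, 0 <= C &
      (ereal_sup (range (fun x : 'rV[R]_d =>
         (enorm (F x) * (1 + enorm x `^ alpha)^-1)%:E)) <= C%:E)%E) :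
  (* (a) *)
  ((exists pi, solvesP mu F alpha pi) -> (vP mu F alpha < +oo)%E ->
   exists (theta : 'rV[R]_p) (N : set (borel_rV R d)),
     [/\ feasible_null mu F alpha N,
         exists pi_theta : probability (borel_rV R d) R,
           [/\ has_density pi_theta mu (gibbs_off mu F N theta),
               solvesP mu F alpha pi_theta &
               forall pi, solvesP mu F alpha pi ->
                 forall A, measurable A -> pi A = pi_theta A] &
         (exists pi : probability (borel_rV R d) R,
            [/\ PFalpha F alpha pi, (KL pi mu < +oo)%E & mu `<< pi]) ->
         [/\ solvesQ mu F alpha theta,
             exists pi : probability (borel_rV R d) R,
               has_density pi mu
                 (fun x => expR (- dotp theta (F x) - logZ mu F theta)) /\
               solvesP mu F alpha pi &
             vQ mu F alpha = vP mu F alpha]]) /\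
  (* (b) *)
  ((exists alpha' eta : R, [/\ alpha < alpha', 0 < eta &
      (\int[mu]_x (expR (eta * enorm x `^ alpha'))%:E < +oo)%E]) ->
   ((exists (theta : 'rV[R]_p) (N : set (borel_rV R d))
        (pi_theta : probability (borel_rV R d) R),
        [/\ feasible_null mu F alpha N,
            has_density pi_theta mu (gibbs_off mu F N theta) &
            solvesP mu F alpha pi_theta]) /\ (vP mu F alpha < +oo)%E
    <->
    exists pi, PFalpha F alpha pi /\ (KL pi mu < +oo)%E)).
Proof.
have [C C0 FC] := F_growth.
have F_le x : enorm (F x) <= C * (1 + enorm x `^ alpha).
  have wx : 0 < 1 + enorm x `^ alpha by rewrite ltr_wpDr ?powR_ge0.
  rewrite -ler_pdivrMr// -lee_fin; apply: le_trans FC.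
  by apply: ereal_sup_ubound; exists x.
have mF := measurable_coordinate F_cont.
(* The constant [k] is kept along with the Gibbs form because the duality argument needs the same
   [theta] and [k]. *)
have solution_gibbs pi f : minimizer mu F (fun x => enorm x `^ alpha) f -> pdf mu f ->
    is_density mu pi f -> exists (theta : 'rV[R]_p) (k : R),
    [/\ 0 < k, {ae mu, forall x, f x = if f x == 0 then 0 else k * expR (- dotp theta (F x))}
      & has_density pi mu (gibbs_off mu F [set x | f x = 0] theta)].
  move=> fm pf pif; have [theta [k [k0 H]]] := minimizer_gibbs mu F alpha C F_cont F_le f fm.
  exists theta, k; split => //.
  apply: (density_has_density mu pi f) => //.
  exact: gibbs_offE k0 H.
split.
- move=> [pi0 sol0] vPoo.
  have Koo : (KL pi0 mu < +oo)%E by rewrite (solvesP_vP mu F alpha).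
  have [f pf pif] := KL_lty_density mu pi0 Koo.
  have fm := solvesP_minimizer mu F alpha C F_cont F_le pi0 f pf pif sol0 Koo.
  have [theta [k [k0 H dens0]]] := solution_gibbs pi0 f fm pf pif.
  exists theta, [set x | f x = 0]; split.
  + exact: (minimizer_feasible_null mu F alpha C F_cont F_le f fm).
  (* Any other solution has a minimizing density too, equal almost everywhere to [f]. *)
  + exists pi0; split => // pi sol A mA.
    have Kpi : (KL pi mu < +oo)%E by rewrite (solvesP_vP mu F alpha).
    have [g pg pig] := KL_lty_density mu pi Kpi.
    have gm := solvesP_minimizer mu F alpha C F_cont F_le pi g pg pig sol Kpi.
    have [mf _ _ _] := pf; have [mg _ _ _] := pg.
    rewrite pif// pig//; apply: ae_eq_integral => //.
    * exact/measurable_EFinP/measurable_funTS.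
    * exact/measurable_EFinP/measurable_funTS.
    * have := minimizer_uniq mu F _ C mF _ g f gm fm.
      move=> /(_ (fun x i => le_trans (le_coord_enorm _ i) (F_le x))).
      by apply: filterS => x -> _.
  + move=> dom.
    have [sQ hd vE] := solvesP_gibbs mu F alpha C F_cont F_le pi0 f theta k pif fm k0 H dom.
    by split => //; exists pi0.
- move=> [alpha' [eta [alphaE eta0 expfin]]]; split.
    move=> [[theta [N [pi [_ _ sol]]]] vPoo]; exists pi.
    by rewrite (solvesP_vP mu F alpha pi sol); split => //; case: sol.
  move=> [pi [PFpi Koo]].
  have [g pg pig] := KL_lty_density mu pi Koo.
  have fg := PFalpha_feasible mu F alpha C F_cont F_le pi g pg pig PFpi Koo.
  (* The gap between [alpha] and [alpha'] supplies exponential moments for every [lambda]. *)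
  have rexpw lambda : rint mu (fun x => expR (lambda * (1 + enorm x `^ alpha))).
    by apply: rint_expR_powR expfin => //; rewrite alpha_ge0.
  have [f fm] := exists_minimizer mu F _ C mF (measurable_enorm_powR alpha)
    (fun x => powR_ge0 _ _) (fun x i => le_trans (le_coord_enorm _ i) (F_le x))
    rexpw (ex_intro _ g fg).
  have [[pf _ _ _] _] := fm.
  have [nu nuf] := exists_density_prob mu f pf.
  have [theta [k [k0 H dens0]]] := solution_gibbs nu f fm pf nuf.
  have sol := minimizer_solvesP mu F alpha C F_cont F_le nu f nuf fm.
  split.
    exists theta, [set x | f x = 0], nu; split => //.
    exact: (minimizer_feasible_null mu F alpha C F_cont F_le f fm).
  (* The value is finite because the given [pi] is a competitor of finite divergence. *)
  rewrite -(solvesP_vP mu F alpha nu sol).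
  by apply: le_lt_trans Koo; case: sol => _; apply.
Qed.
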